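(* Let $\mathcal E$ be a nest on a complex Banach space $X$ having the $p$-property and let $(\Phi,\Psi)$ be an admissible support function pair on $\mathcal E$. Then $\mathcal M(\Phi,\Psi)=\mathcal M(\Phi)\cap\mathcal M^e(\Psi)$ is a $\mathcal T(\mathcal E)$-bimodule whose support function pair $(\Phi_{\mathcal M(\Phi,\Psi)},\Phi^e_{\mathcal M(\Phi,\Psi)})$ equals $(\Phi,\Psi)$, and it contains every $\mathcal T(\mathcal E)$-bimodule whose support function pair is $(\Phi,\Psi)$.
   Context: A nest $\mathcal E$ on $X$ is a family of closed linear subspaces of $X$, totally ordered by inclusion, containing $\{0\}$ and $X$, closed under arbitrary meets $\wedge$ (intersections) and joins $\vee$ (norm-closed linear spans of unions). For $E\in\mathcal E$, $E_-=\vee\{F\in\mathcal E: F\subsetneq E\}$ and $E_+=\wedge\{F\in\mathcal E: E\subsetneq F\}$. $\mathcal E$ has the $p$-property if (i) for every $N=N_-$ in $\mathcal E$ there is a strictly increasing sequence $(N_k)$ in $\mathcal E$ with $\vee_k N_k=N$, and (ii) for every $N=N_+$ there is a strictly decreasing sequence $(N_k)$ in $\mathcal E$ with $\wedge_kN_k=N$. $\mathcal T(\mathcal E)=\{T\in\mathcal B(X): TE\subseteq E\ \forall E\in\mathcal E\}$; a $\mathcal T(\mathcal E)$-bimodule is a linear subspace $\mathcal J\subseteq\mathcal B(X)$ with $\mathcal T(\mathcal E)\mathcal J,\mathcal J\mathcal T(\mathcal E)\subseteq\mathcal J$. For subspaces $M,L$ ($L$ closed), $M/L=\{m+L:m\in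 M\}$ and $\dim(M/L)$ is its dimension. A support function is an inclusion-preserving map $\mathcal E\to\mathcal E$; it is admissible if for all $N\neq\{0\}$, $\vee_{E\subsetneq N}\Phi(E)=\Phi(N_-)$. $\Phi\le\Theta$ means $\Phi(E)\subseteq\Theta(E)$ for all $E$. $\mathcal E_f=\{N\in\mathcal E: 0<\dim(N/N_-)<\infty\}$. An essential support function is a support function $\Psi$ such that for all $N,N_1,N_2\in\mathcal E$ with $N_1\subseteq N_2$: (a) $\Psi(N)\in\mathcal E_f\Rightarrow\Psi(N)=\Psi(N)_+$; (b) $\dim(N_2/N_1)<\infty\Rightarrow\Psi(N_2)=\Psi(N_1)$. An admissible support function pair is a pair $(\Phi,\Psi)$ with $\Phi$ admissible, $\Phi(\{0\})=\{0\}$, $\Psi$ an essential support function, $\Psi\le\Phi$, and $\Psi(N)\in\mathcal E_f\Rightarrow\Psi(N)\subsetneq\Phi(N)$ for all $N$. $\mathcal M(\Phi)=\{T\in\mathcal B(X): TE\subseteq\Phi(E)\ \forall E\}$; $\mathcal M^e(\Psi)=\{T\in\mathcal B(X): \dim(TN/L)<\infty$ for all $N,L\in\mathcal E$ with $L_+\supsetneq\Psi(N)\}$. The support function pair of a bimodule $\mathcal J$ is $(\Phi_{\mathcal J},\Phi^e_{\mathcal J})$ with $\Phi_{\mathcal J}(E)=[\mathcal JE]$ (norm-closed linear span of $\{Tx:T\in\mathcal J,x\in E\}$) and $\Phi^e_{\mathcal J}(N)=\wedge\{L\in\mathcal E:\dim(TN/L)<\infty\ \forall T\in\mathcal J\}$.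 *)

(* Defs.v *)
From HB Require Import structures.
From mathcomp Require Import all_boot all_order all_algebra complex.
From mathcomp Require Import all_classical all_reals all_analysis.
Import numFieldNormedType.Exports.
Set Implicit Arguments. Unset Strict Implicit. Unset Printing Implicit Defensive.
Import Order.TTheory GRing.Theory Num.Theory.
Local Open Scope classical_set_scope.
Local Open Scope ring_scope.

Section NestDefs.
Context {K : numFieldType} {X : normedModType K}.

Definition psub (E F : set X) : Prop := E `<=` F /\ E <> F.

Definition is_subspace (M : set X) : Prop :=
  M 0 /\ forall (a : K) (x y : X), M x -> M y -> M (a *: x + y).
Definition closed_subspace (M : set X) : Prop := is_subspace M /\ closed M.

Definition cspan (S : set X) : set X :=
  [set x | forall M, closed_subspace M -> S `<=` M -> M x].

Definition join (F : set (set X)) : set X := cspan (\bigcup_(E in F) E).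
Definition meet (F : set (set X)) : set X := \bigcap_(E in F) E.

Definition is_nest (N : set (set X)) : Prop :=
  [/\ (forall E, N E -> closed_subspace E),
      (forall E F, N E -> N F -> E `<=` F \/ F `<=` E),
      N [set 0], N setT
    & forall F, F `<=` N -> N (meet F) /\ N (join F)].

Definition nest_minus (N : set (set X)) (E : set X) : set X :=
  join [set F | N F /\ psub F E].
Definition nest_plus (N : set (set X)) (E : set X) : set X :=
  meet [set F | N F /\ psub E F].

Definition p_property (N : set (set X)) : Prop :=
  (forall M, N M -> M <> [set 0] -> M = nest_minus N M ->
     exists u : nat -> set X, (forall k, N (u k)) /\
       (forall k, psub (u k) (u k.+1)) /\ join (range u) = M) /\
  (forall M, N M -> M <> setT -> M = nest_plus N M ->
     exists u : nat -> set X, (forall k, N (u k)) /\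
       (forall k, psub (u k.+1) (u k)) /\ meet (range u) = M).

(* dim (M/L) < oo : the classes m + L, m in M, lie in the span of the
   classes of finitely many vectors *)
Definition quot_findim (M L : set X) : Prop :=
  exists s : seq X, forall m, M m ->
    exists c : nat -> K, L (m - \sum_(i < size s) c i *: s`_i).
Definition quot_pos (M L : set X) : Prop := exists m, M m /\ ~ L m.

Definition is_bop (T : X -> X) : Prop :=
  (forall (a : K) (x y : X), T (a *: x + y) = a *: T x + T y) /\ continuous T.
Definition is_opspace (J : set (X -> X)) : Prop :=
  [/\ J `<=` is_bop, J (fun _ => 0)
    & forall (a : K) T S, J T -> J S -> J (fun x => a *: T x + S x)].

Definition nest_alg (N : set (set X)) : set (X -> X) :=
  [set T | is_bop T /\ forall E, N E -> T @` E `<=` E].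
Definition is_bimodule (N : set (set X)) (J : set (X -> X)) : Prop :=
  is_opspace J /\
  forall A T, nest_alg N A -> J T -> J (A \o T) /\ J (T \o A).

Definition PhiJ (J : set (X -> X)) (E : set X) : set X :=
  cspan [set y | exists T x, [/\ J T, E x & y = T x]].
Definition PhieJ (N : set (set X)) (J : set (X -> X)) (M : set X) : set X :=
  meet [set L | N L /\ forall T, J T -> quot_findim (T @` M) L].

Definition support_fun (N : set (set X)) (Phi : set X -> set X) : Prop :=
  (forall E, N E -> N (Phi E)) /\
  (forall E F, N E -> N F -> E `<=` F -> Phi E `<=` Phi F).
Definition admissible (N : set (set X)) (Phi : set X -> set X) : Prop :=
  support_fun N Phi /\
  forall M, N M -> M <> [set 0] ->
    join [set Phi E | E in [set E | N E /\ psub E M]] = Phi (nest_minus N M).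
Definition Ef (N : set (set X)) (M : set X) : Prop :=
  [/\ N M, quot_pos M (nest_minus N M) & quot_findim M (nest_minus N M)].
Definition essential (N : set (set X)) (Psi : set X -> set X) : Prop :=
  [/\ support_fun N Psi,
      (forall M, N M -> Ef N (Psi M) -> Psi M = nest_plus N (Psi M))
    & (forall N1 N2, N N1 -> N N2 -> N1 `<=` N2 -> quot_findim N2 N1 ->
         Psi N2 = Psi N1)].
Definition admissible_pair (N : set (set X)) (Phi Psi : set X -> set X) : Prop :=
  [/\ admissible N Phi, Phi [set 0] = [set 0], essential N Psi,
      (forall E, N E -> Psi E `<=` Phi E)
    & (forall E, N E -> Ef N (Psi E) -> psub (Psi E) (Phi E))].

Definition MPhi (N : set (set X)) (Phi : set X -> set X) : set (X -> X) :=
  [set T | is_bop T /\ forall E, N E -> T @` E `<=` Phi E].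
Definition MePsi (N : set (set X)) (Psi : set X -> set X) : set (X -> X) :=
  [set T | is_bop T /\ forall M L, N M -> N L ->
     psub (Psi M) (nest_plus N L) -> quot_findim (T @` M) L].

End NestDefs.

(* Main.v *)
Require Import Defs.
From HB Require Import structures.
From mathcomp Require Import all_boot all_order all_algebra complex.
From mathcomp Require Import all_classical all_reals all_analysis.
From mathcomp Require Import ring lra.
Import numFieldNormedType.Exports.
Set Implicit Arguments. Unset Strict Implicit. Unset Printing Implicit Defensive.
Import Order.TTheory GRing.Theory Num.Theory.
Local Open Scope classical_set_scope.
Local Open Scope ring_scope.
Local Open Scope complex_scope.

(** Only two facts are not formal: [Phi] and [Psi] are attained. For [Phi], the
rank-one operators [x |-> f x *: y] with [y] in [Phi F] and [f] in the annihilator of a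
smaller nest element suffice. For [Psi], let [L] be a nest element strictly
inside [P = Psi M]; we need [T] in [M(Phi, Psi)] with [dim (T M / L)] infinite.
Let [D] be the join of the [F] with [Psi F] strictly inside [P]. Take
[T x = sum_k c_k f_k(x) y_k], where [f_k] has a biorthogonal sequence [x_k] in [M]
and eventually vanishes on each such [F], and the [y_k] are independent modulo
[L] and approach [P]; then [T x_k = c_k y_k].
 - If [Psi D] is strictly inside [P], then [dim (M / D)] is infinite and [f_k]
   vanishes on [D], or on [E_(k+1)] for nest elements [E_k] decreasing to [D].
   Otherwise [D] is its own predecessor and [f_k] vanishes on the terms of a
   sequence increasing to [D].
 - If [P] is not in [E_f], then [dim (P / L)] is infinite and [y_k] lies in [P].
   Otherwise [P] is its own successor, [Phi F] is strictly larger than [P] as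
   soon as [Psi F] contains [P], and [y_k] lies in the terms of a sequence
   decreasing to [P]. *)

(** * Hahn-Banach extension for a sublinear functional on a real vector space *)

Section RealHahnBanach.
Context {R : realType} {V : lmodType R}.
Variable p : V -> R.
Hypothesis p_sub : forall x y, p (x + y) <= p x + p y.
Hypothesis p_homo : forall t x, 0 < t -> p (t *: x) = t * p x.

(* Linear functionals on subspaces, dominated by [p], as graphs. *)
Definition dominated_graph (G : set (V * R)) : Prop :=
  [/\ G (0, 0),
      (forall t x y r s, G (x, r) -> G (y, s) -> G (t *: x + y, t * r + s))
    & (forall x r, G (x, r) -> r <= p x)].

(** One-dimensional extension step. Subadditivity of [p] puts every lower bound [r - p (v - x0)] for
    the value at [x0] below every upper bound [p (w + x0) - s], so the supremum of the lower bounds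
    is an admissible value. *)
Lemma dominated_graph_extend (G : set (V * R)) (x0 : V) : dominated_graph G ->
  exists a, dominated_graph
    [set z | exists v r t, G (v, r) /\ z = (v + t *: x0, r + t * a)].
Proof.
move=> [G0 Glin Gdom].
have Gdiff v r w s : G (v, r) -> G (w, s) -> r - p (v - x0) <= p (w + x0) - s.
  move=> Gv Gw; have := Gdom _ _ (Glin 1 _ _ _ _ Gv Gw).
  rewrite scale1r mul1r => h.
  suff : r + s <= p (v - x0) + p (w + x0) by lra.
  by apply: le_trans h (le_trans _ (p_sub _ _)); rewrite addrACA addNr addr0.
pose A := [set r | exists v s, G (v, s) /\ r = s - p (v - x0)].
have A0 : A !=set0 by exists (0 - p (0 - x0)), 0, 0.
have Aub w s : G (w, s) -> ubound A (p (w + x0) - s).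
  by move=> Gw _ [v [r [Gv ->]]]; exact: Gdiff.
have As : has_sup A by split=> //; exists (p (0 + x0) - 0); exact: Aub.
exists (sup A).
have lo v r : G (v, r) -> r - p (v - x0) <= sup A.
  by move=> Gv; apply: sup_upper_bound => //; exists v, r.
have hi v r : G (v, r) -> sup A <= p (v + x0) - r.
  by move=> Gv; apply: sup_le_ub => //; exact: Aub.
split.
- by exists 0, 0, 0; rewrite scale0r mul0r !addr0.
- move=> t x y r s [v [r1 [t1 [Gv [-> ->]]]]] [w [r2 [t2 [Gw [-> ->]]]]].
  exists (t *: v + w), (t * r1 + r2), (t * t1 + t2); split; first exact: Glin.
  congr pair; last by ring.
  by rewrite scalerDr scalerDl scalerA addrACA.
- move=> _ _ [v [r [t [Gv [-> ->]]]]].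
  have Gsc u : G (u *: v, u * r) by have := Glin u _ _ _ _ Gv G0; rewrite !addr0.
  (* Homogeneity reduces [t < 0] to [lo] and [t > 0] to [hi], both taken at the point of the graph
     divided by the absolute value of [t]. *)
  have [t0|t0|->] := ltgtP t 0; last by rewrite scale0r mul0r !addr0; exact: Gdom.
  + have nt : 0 < - t by rewrite oppr_gt0.
    have := lo _ _ (Gsc (- t)^-1).
    rewrite -(ler_pM2l nt) mulrBr mulVKf ?gt_eqF// -p_homo//.
    rewrite scalerBr scalerA mulfV ?gt_eqF// scale1r scaleNr opprK.
    by lra.
  + have := hi _ _ (Gsc t^-1).
    rewrite -(ler_pM2l t0) mulrBr mulVKf ?gt_eqF// -p_homo//.
    rewrite scalerDr scalerA mulfV ?gt_eqF// scale1r.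
    by lra.
Qed.

Theorem hahn_banach_dominated (G0 : set (V * R)) : dominated_graph G0 ->
  exists g : V -> R,
    [/\ (forall t x y, g (t *: x + y) = t * g x + g y),
        (forall x, g x <= p x)
      & (forall x r, G0 (x, r) -> g x = r)].
Proof.
move=> domG0.
(* Taking the union with [G0] makes the condition hold for the empty chain and forces the maximal
   graph to extend [G0]. *)
have [F FP Ftot|A [domA maxA]] :=
    @Zorn_bigcup _ [set A | dominated_graph (A `|` G0)].
  rewrite /=; have [->|/set0P[A1 FA1]] := eqVneq F set0.
    by rewrite bigcup_set0 set0U.
  split.
  - by right; case: domG0.
  - move=> t x y r s [[A FA Ax]|G0x] [[B FB By]|G0y].
    + have [AB|BA] := Ftot _ _ FA FB.
      * have [_ lin _] := FP _ FB.
        have [] := lin t _ _ _ _ (or_introl (AB _ Ax)) (or_introl By);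
          by [left; exists B|right].
      * have [_ lin _] := FP _ FA.
        have [] := lin t _ _ _ _ (or_introl Ax) (or_introl (BA _ By));
          by [left; exists A|right].
    + have [_ lin _] := FP _ FA.
      have [] := lin t _ _ _ _ (or_introl Ax) (or_intror G0y);
        by [left; exists A|right].
    + have [_ lin _] := FP _ FB.
      have [] := lin t _ _ _ _ (or_intror G0x) (or_introl By);
        by [left; exists B|right].
    + by right; case: domG0 => _ lin _; exact: lin.
  - move=> x r [[A FA Ax]|G0x]; last by case: domG0 => _ _; apply.
    by have [_ _] := FP _ FA; apply; left.
pose G := A `|` G0; have [Gz Glin Gdom] : dominated_graph G := domA.
have Gtot x : exists r, G (x, r).
  have [a] := dominated_graph_extend x domA.
  set G' := (X in dominated_graph X) => domG'.
  have GG' : G `<=` G'.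
    move=> [v r] Gv; exists v, r, 0; split => //.
    by rewrite scale0r mul0r !addr0.
  have G'x : G' (x, a) by exists 0, 0, 1; rewrite scale1r mul1r !add0r.
  exists a; apply: contrapT => nGx; apply: (maxA G').
    split; first by apply: subset_trans GG'; exact: subsetUl.
    by move=> /(_ _ G'x) Ax; apply: nGx; left.
  rewrite /=; suff -> : G' `|` G0 = G' by [].
  by apply/setUidl; apply: subset_trans GG'; exact: subsetUr.
(* Two values at [x] differ by a value of the graph at [0], which is at most [p 0]; homogeneity at
   [0] with factor 2 gives [p 0 <= 0]. *)
have Guniq x r s : G (x, r) -> G (x, s) -> r = s.
  have key r1 s1 : G (x, r1) -> G (x, s1) -> r1 <= s1.
    move=> Gr Gs; have := Gdom _ _ (Glin (-1) _ _ _ _ Gs Gr).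
    have p0 : p 0 <= 0.
      by have := p_homo 0 (ltr0n R 2); rewrite scaler0; lra.
    by rewrite scaleN1r addNr => /le_trans/(_ p0); lra.
  by move=> Gr Gs; apply/eqP; rewrite eq_le !key.
have [g Gg] := choice Gtot.
exists g; split.
- by move=> t x y; apply: (Guniq (t *: x + y)) => //; exact: Glin.
- by move=> x; exact: Gdom.
- by move=> x r G0x; apply: (Guniq x) => //; right.
Qed.
End RealHahnBanach.

(** * Restriction of scalars; the alias keeps the real module structure apart from the complex
    one *)

Definition realification {R : realType} (X : lmodType R[i]) : Type := X.

Section Realification.
Context {R : realType} {X : lmodType R[i]}.
HB.instance Definition _ := GRing.Zmodule.on (realification X).

Definition realscale (t : R) (x : realification X) : realification X :=
  (t%:C : R[i]) *: (x : X).

Let realscaleA a b v : realscale a (realscale b v) = realscale (a * b) v.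
Proof. by rewrite /realscale scalerA -rmorphM. Qed.
Let realscale1 : left_id 1 realscale.
Proof. by move=> v; rewrite /realscale rmorph1 scale1r. Qed.
Let realscaleDr : right_distributive realscale +%R.
Proof. by move=> a u v; rewrite /realscale scalerDr. Qed.
Let realscaleDl v : {morph realscale^~ v : a b / a + b}.
Proof. by move=> a b; rewrite /realscale rmorphD scalerDl. Qed.

HB.instance Definition _ := GRing.Zmodule_isLmodule.Build R (realification X)
  realscaleA realscale1 realscaleDr realscaleDl.

Lemma realscaleE (t : R) (x : realification X) : t *: x = (t%:C : R[i]) *: (x : X) :> X.
Proof. by []. Qed.
End Realification.

(** * Separation of a point from a closed subspace over the complex numbers *)

Section ComplexHahnBanach.
Context {R : realType} {X : normedModType R[i]}.

Definition bounded_functional (f : X -> R[i]) : Prop :=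
  (forall a x y, f (a *: x + y) = a * f x + f y) /\
  exists C : R, forall x, `|f x| <= C%:C * `|x|.

(** The norm of [X] takes its values in [R[i]]; this passes between it and its real part, where
    real-valued arguments apply. *)
Lemma Re_normK (x : X) : (complex.Re `|x|)%:C = `|x|.
Proof. by apply: RRe_real; exact: normr_real. Qed.

Lemma Re_normD (x y : X) :
  complex.Re `|x + y| <= complex.Re `|x| + complex.Re `|y|.
Proof. by rewrite -lecR rmorphD/= !Re_normK; exact: ler_normD. Qed.

Lemma Re_normZ (t : R) (x : X) :
  complex.Re `|t%:C *: x| = `|t| * complex.Re `|x|.
Proof.
apply: complexI; rewrite rmorphM/= !Re_normK normrZ; congr (_ * _).
by rewrite normc_def/= expr0n/= addr0 sqrtr_sqr.
Qed.

Lemma closed_dist (B : set X) (x0 : X) : closed B -> ~ B x0 ->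
  exists2 d : R, 0 < d & forall b, B b -> d <= complex.Re `|x0 - b|.
Proof.
move=> clB nBx0.
have : nbhs x0 (~` B) by apply: open_nbhs_nbhs; split=> //; exact: closed_openC.
move=> /nbhs_normP[e /= e0 eB]; exists (complex.Re e).
  by move: e0; rewrite ltcE => /andP[].
move=> b Bb; have eE : e = (complex.Re e)%:C by rewrite RRe_real// gtr0_real.
rewrite -lecR Re_normK -eE real_leNgt ?normr_real ?gtr0_real//.
by apply/negP => h; exact: (eB b h).
Qed.

(** With [d] a positive lower bound for the distance from [x0] to [B], the real functional
    [b + t x0 |-> t d] is dominated by the norm. Its extension [g] is the real part of the complex
    functional [x |-> g x - i g (i x)], which kills [B] because [B] is stable under [i]; dividing by
    the value at [x0] normalises it. *)
Theorem hahn_banach_separation (B : set X) (x0 : X) :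
  closed_subspace B -> ~ B x0 ->
  exists f, [/\ bounded_functional f, forall b, B b -> f b = 0 & f x0 = 1].
Proof.
move=> [[B0 Blin] clB] nBx0.
have [d d0 dB] := closed_dist clB nBx0.
pose V := realification X.
pose p (x : V) : R := complex.Re `|x : X|.
have p_sub (x y : V) : p (x + y) <= p x + p y by exact: Re_normD.
have p_homo t (x : V) : 0 < t -> p (t *: x) = t * p x.
  by move=> t0; rewrite /p realscaleE Re_normZ gtr0_norm.
pose G0 : set (V * R) :=
  [set z | exists b t, B b /\ z = ((b : V) + t *: (x0 : V), t * d)].
have domG0 : dominated_graph p G0.
  split.
  - by exists 0, 0; rewrite scale0r mul0r addr0.
  - move=> t x y r s [b [t1 [Bb [-> ->]]]] [c [t2 [Bc [-> ->]]]].
    exists ((t *: (b : V)) + c : V), (t * t1 + t2); split; first exact: Blin.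
    by rewrite scalerDr scalerDl scalerA addrACA mulrDl mulrA.
  - move=> _ _ [b [t [Bb [-> ->]]]].
    have p0 (x : V) : 0 <= p x.
      by rewrite -lecR Re_normK rmorph0 normr_ge0.
    have [t0|t0] := leP t 0; first by apply: le_trans (p0 _); nra.
    have -> : (b : V) + t *: (x0 : V) = t *: ((x0 : V) + t^-1 *: (b : V)).
      by rewrite scalerDr scalerA mulfV ?gt_eqF// scale1r addrC.
    rewrite p_homo// ler_pM2l//.
    have := dB (- t^-1%:C *: b); rewrite scaleNr opprK; apply.
    by have := Blin (- t^-1%:C) _ _ Bb B0; rewrite addr0 scaleNr.
have [g [glin gp gG0]] := hahn_banach_dominated p_sub p_homo domG0.
have gx0 : g x0 = d.
  apply: gG0; exists 0, 1; rewrite scale1r mul1r add0r; split=> //.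
have gB b : B b -> g b = 0.
  by move=> Bb; apply: gG0; exists b, 0; rewrite scale0r mul0r addr0.
have gD (x y : X) : g (x + y) = g x + g y.
  by have := glin 1 x y; rewrite scale1r mul1r.
have g0 : g 0 = 0 by exact: gB.
have gZ (t : R) (x : X) : g (t%:C *: x) = t * g x.
  by have := glin t x 0; rewrite addr0 g0 addr0.
have gN (x : X) : g (- x) = - g x.
  by have := gZ (-1) x; rewrite rmorphN1 scaleN1r mulN1r.
pose f (x : X) : R[i] := g x +i* (- g ('i *: x)).
have flin a x y : f (a *: x + y) = a * f x + f y.
  have fD u v : f (u + v) = f u + f v.
    by rewrite /f scalerDr !gD opprD.
  have fZ t u : f (t%:C *: u) = t%:C * f u.
    rewrite /f scalerA mulrC -scalerA !gZ; apply/eqP.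
    by rewrite eq_complex /=; apply/andP; split; apply/eqP; ring.
  have fi u : f ('i *: u) = 'i * f u.
    rewrite /f scalerA -expr2 sqr_i scaleN1r gN; apply/eqP.
    by rewrite eq_complex /=; apply/andP; split; apply/eqP; ring.
  rewrite fD [in LHS](complexE a) scalerDl -scalerA fD fZ fi fZ.
  by rewrite [in RHS](complexE a) mulrDl mulrA.
have fx0 : f x0 != 0.
  by apply/eqP => /(congr1 (@complex.Re R))/= h; move: d0; rewrite -gx0 h ltxx.
have gabs x : `|g x| <= complex.Re `|x|.
  rewrite ler_norml gp andbT lerNl -gN; apply: (le_trans (gp _)).
  by rewrite /p normrN.
exists (fun x => (f x0)^-1 * f x); split; last by rewrite mulVf.
  split; first by move=> a x y; rewrite flin; ring.
  have [c c0 cE] : exists2 c : R, 0 <= c & `|(f x0)^-1| = c%:C.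
    by exists (complex.Re `|(f x0)^-1|); rewrite -?ler0c RRe_real ?normr_real.
  (* The factor 2 bounds real and imaginary part separately, each by the norm of [x]; [c] comes from
     the normalisation. *)
  exists (c * 2) => x.
  rewrite normrM cE rmorphM -mulrA; apply: ler_wpM2l; first by rewrite ler0c.
  rewrite [f x]complexE; apply: (le_trans (ler_normD _ _)).
  rewrite normrM.
  have -> : `|'i : R[i]| = 1 by rewrite normc_def/= expr0n/= add0r expr1n sqrtr1.
  have nR (t : R) : `|t%:C| = `|t|%:C :> R[i].
    by rewrite normc_def/= expr0n/= addr0 sqrtr_sqr.
  rewrite mul1r !nR /= normrN -Re_normK -!rmorphD -rmorphM/= lecR.
  have := gabs x; have := gabs ('i *: x).
  have -> : `|('i : R[i]) *: x| = `|x|.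
    rewrite normrZ; have -> : `|'i : R[i]| = 1 by rewrite normc_def/= expr0n/= add0r expr1n sqrtr1.
    by rewrite mul1r.
  lra.
move=> b Bb; suff -> : f b = 0 by rewrite mulr0.
rewrite /f gB// gB ?oppr0//.
by have := Blin 'i _ _ Bb B0; rewrite addr0.
Qed.
End ComplexHahnBanach.

(** Dependent choice in which each term may depend on the whole list of earlier terms. *)
Lemma seq_choice (T : Type) (P : seq T -> T -> Prop) :
  (forall s, exists t, P s t) -> exists u : nat -> T, forall n, P (mkseq u n) (u n).
Proof.
move=> /choice[g Pg]; pose l := fix l n := if n is m.+1 then rcons (l m) (g (l m)) else [::].
exists (fun n => g (l n)) => n; suff -> : mkseq (fun n => g (l n)) n = l n by [].
by elim: n => // n IH; rewrite mkseqS IH.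
Qed.

(** * Linear algebra modulo a subspace: finite-dimensional quotients and free sequences *)

Section Subspaces.
Context {K : numFieldType} {X : normedModType K}.
Implicit Types (E F L M V : set X) (s : seq X).

Lemma psub_not_sub E F : psub E F -> ~ F `<=` E.
Proof. by move=> [EF ne] FE; apply: ne; apply/seteqP. Qed.

Lemma psub_sub_trans E F V : psub E F -> F `<=` V -> psub E V.
Proof.
move=> EF FV; split; first by apply: subset_trans FV; case: EF.
by move=> EV; apply: (psub_not_sub EF); rewrite EV.
Qed.

Lemma sub_psub_trans E F V : E `<=` F -> psub F V -> psub E V.
Proof.
move=> EF FV; split; first by apply: (subset_trans EF); case: FV.
by move=> EV; apply: (psub_not_sub FV); rewrite -EV.
Qed.

Lemma psub_exists E F : psub E F -> exists2 x, F x & ~ E x.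
Proof.
move=> EF; apply: contrapT => h; apply: (psub_not_sub EF) => x Fx.
by apply: contrapT => nEx; apply: h; exists x.
Qed.

Lemma decreasing_sub (u : nat -> set X) i j :
  (forall k, psub (u k.+1) (u k)) -> (i <= j)%N -> u j `<=` u i.
Proof.
move=> du /subnK <-; elim: (j - i)%N => // m IH.
by apply: subset_trans IH; case: (du (m + i)%N).
Qed.

Lemma increasing_sub (u : nat -> set X) i j :
  (forall k, psub (u k) (u k.+1)) -> (i <= j)%N -> u i `<=` u j.
Proof.
move=> iu /subnK <-; elim: (j - i)%N => // m IH.
by apply: (subset_trans IH); case: (iu (m + i)%N).
Qed.

Lemma subspace0 M : is_subspace M -> M 0. Proof. by case. Qed.

Lemma subspaceZ M a x : is_subspace M -> M x -> M (a *: x).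
Proof. by move=> [M0 Ml] Mx; rewrite -[_ *: _]addr0; exact: Ml. Qed.

Lemma subspaceD M x y : is_subspace M -> M x -> M y -> M (x + y).
Proof. by move=> [M0 Ml] Mx My; rewrite -[x]scale1r; exact: Ml. Qed.

Lemma subspaceB M x y : is_subspace M -> M x -> M y -> M (x - y).
Proof. by move=> [M0 Ml] Mx My; rewrite addrC -scaleN1r; exact: Ml. Qed.

Lemma subspace_sum M I (r : seq I) (P : pred I) (F : I -> X) :
  is_subspace M -> (forall i, P i -> M (F i)) -> M (\sum_(i <- r | P i) F i).
Proof.
move=> sM MF; elim/big_ind: _ => //; first exact: subspace0.
by move=> x y; exact: subspaceD.
Qed.

(* The subspace [L + span s]; [quot_findim M L] unfolds to [M `<=` add_span L s]
   for some [s]. *)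
Definition add_span L s : set X :=
  [set m | exists c : nat -> K, L (m - \sum_(i < size s) c i *: s`_i)].

Lemma add_span_nil L m : add_span L [::] m <-> L m.
Proof.
split=> [[c]|Lm]; first by rewrite big_ord0 subr0.
by exists (fun=> 0); rewrite big_ord0 subr0.
Qed.

Lemma add_span_cons L x s m :
  add_span L (x :: s) m <-> exists a, add_span L s (m - a *: x).
Proof.
split=> [[c]|[a [c]]].
  by rewrite big_ord_recl /= opprD addrA => h; exists (c 0%N), (c \o succn).
move=> h; exists (fun i => if i is j.+1 then c j else a).
by rewrite big_ord_recl /= opprD addrA.
Qed.

Lemma add_span_subspace L s : is_subspace L -> is_subspace (add_span L s).
Proof.
move=> [L0 Ll]; split.
  by exists (fun=> 0); rewrite big1 ?subr0// => i _; rewrite scale0r.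
move=> a x y [c Lc] [d Ld]; exists (fun i => a * c i + d i).
rewrite (_ : _ - _ = a *: (x - \sum_(i < size s) c i *: s`_i) +
    (y - \sum_(i < size s) d i *: s`_i)); first exact: Ll.
rewrite scalerBr addrACA -opprD scaler_sumr -big_split/=; congr (_ - _).
by apply: eq_bigr => i _; rewrite scalerDl scalerA.
Qed.

Lemma sub_add_span L s : L `<=` add_span L s.
Proof.
by move=> x Lx; exists (fun=> 0); rewrite big1 ?subr0// => i _; rewrite scale0r.
Qed.

Lemma mem_add_span L s x : is_subspace L -> x \in s -> add_span L s x.
Proof.
move=> sL xs; exists (fun i => if i == index x s then 1 else 0).
have ltx : (index x s < size s)%N by rewrite index_mem.
rewrite (bigD1 (Ordinal ltx))//= eqxx scale1r nth_index// big1 ?addr0 ?subrr.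
  exact: subspace0.
move=> i; rewrite -val_eqE/= => /negPf ->; exact: scale0r.
Qed.

Lemma add_span_min L s M : is_subspace M -> L `<=` M ->
  (forall x, x \in s -> M x) -> add_span L s `<=` M.
Proof.
move=> sM LM sMs x [c Lc]; rewrite -[x](subrK (\sum_(i < size s) c i *: s`_i)).
apply: subspaceD => //; first exact: LM.
by apply: subspace_sum => // i _; apply: subspaceZ => //; apply: sMs; exact: mem_nth.
Qed.

Lemma sub_quot_findim M M' L L' : M `<=` M' -> L' `<=` L ->
  quot_findim M' L' -> quot_findim M L.
Proof. by move=> MM LL [s h]; exists s => m /MM/h[c Lc]; exists c; exact: LL. Qed.

Lemma not_quot_findim M L :
  ~ quot_findim M L -> forall s, exists2 y, M y & ~ add_span L s y.
Proof.
move=> nq s; apply: contrapT => h; apply: nq; exists s => m Mm.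
by apply: contrapT => nm; apply: h; exists m.
Qed.

Lemma quot_findim_lin (T : X -> X) M L L' :
  (forall a x y, T (a *: x + y) = a *: T x + T y) -> T @` L `<=` L' ->
  quot_findim M L -> quot_findim (T @` M) L'.
Proof.
move=> Tl TL [s Ms]; exists (map T s) => _ [m Mm <-]; have [c Lc] := Ms _ Mm.
exists c; apply: TL; exists (m - \sum_(i < size s) c i *: s`_i) => //.
have T0 : T 0 = 0.
  by apply: (addrI (T 0)); have := Tl 1 0 0; rewrite !scale1r !addr0.
rewrite addrC -scaleN1r Tl scaleN1r addrC size_map; congr (_ - _).
elim: s c {Lc Ms} => [|x s IH] c; first by rewrite !big_ord0.
by rewrite !big_ord_recl Tl (IH (c \o succn)).
Qed.

(* The coefficients of [n > size s] vectors with respect to [s] are linearly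
   dependent, and the last vector of a dependency lies in the span of its
   predecessors modulo [L]. *)
Lemma free_leq_size L s (y : nat -> X) n : is_subspace L ->
  (forall k, (k < n)%N -> ~ add_span L (mkseq y k) (y k)) ->
  (forall k, (k < n)%N -> add_span L s (y k)) -> (n <= size s)%N.
Proof.
move=> sL yfree ys; rewrite leqNgt; apply/negP => ltsn.
have /choice[c Lc] : forall k : 'I_n, exists c : nat -> K,
    L (y k - \sum_(i < size s) c i *: s`_i) by move=> k; exact: ys.
pose A : 'M[K]_(n, size s) := \matrix_(k, i) c k i.
have : kermx A != 0.
  by rewrite -mxrank_eq0 mxrank_ker -lt0n subn_gt0 (leq_ltn_trans (rank_leq_col _)).
case/rowV0Pn => w /sub_kermxP wA w0.
have Lw : L (\sum_(k < n) w 0 k *: y k).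
  rewrite (_ : \sum_(k < n) _ = \sum_(k < n) w 0 k *:
      (y k - \sum_(i < size s) c k i *: s`_i)).
    by apply: subspace_sum => // k _; exact: subspaceZ.
  under [in RHS]eq_bigr do rewrite scalerBr.
  rewrite sumrB -[LHS]subr0; congr (_ - _).
  under [in RHS]eq_bigr do rewrite scaler_sumr.
  rewrite exchange_big/= big1// => i _.
  under eq_bigr do rewrite scalerA.
  rewrite -scaler_suml; have /rowP/(_ i) := wA; rewrite !mxE.
  under eq_bigr do rewrite mxE.
  by move->; rewrite scale0r.
have [v vE] : exists v : nat -> K, forall k : 'I_n, v k = w 0 k.
  by exists (fun k => if insub k is Some i then w 0 i else 0) => k; rewrite valK.
have v0 k : (k < n)%N -> v k = 0.
  have Lv : L (\sum_(i < n) v i *: y i) by under eq_bigr do rewrite vE.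
  elim: n yfree Lv {ys ltsn c Lc A wA w w0 Lw vE} (leqnn n) k => // m IH yf Lv _ k km.
  have vm0 : v m = 0.
    apply: contrapT => /eqP vm0; apply: (yf m) => //.
    exists (fun i => - ((v m)^-1 * v i)); rewrite size_mkseq.
    have := subspaceZ (v m)^-1 sL Lv; rewrite big_ord_recr/= scalerDr scalerA.
    rewrite mulVf// scale1r addrC scaler_sumr; congr (L (_ + _)).
    rewrite -sumrN; apply: eq_bigr => i _.
    by rewrite nth_mkseq// scaleNr opprK scalerA.
  move: km; rewrite ltnS leq_eqVlt => /predU1P[->//|km]; apply: IH => //.
    by move=> j jm; apply: yf; exact: ltnW.
  by move: Lv; rewrite big_ord_recr/= vm0 scale0r addr0.
case/negP: w0; apply/eqP/rowP => k; rewrite mxE -vE; exact: v0.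
Qed.

Lemma free_not_quot_findim M L (y : nat -> X) : is_subspace L ->
  (forall k, ~ add_span L (mkseq y k) (y k)) -> (forall k, M (y k)) ->
  ~ quot_findim M L.
Proof.
move=> sL yf My [s Ms].
have := @free_leq_size L s y (size s).+1 sL (fun k _ => yf k) (fun k _ => Ms _ (My k)).
by rewrite ltnn.
Qed.

(** Choose [y k] in [E k] outside [E k.+1]. Freeness compares a vector with its predecessors, so a
    finite stretch is listed backwards, as [y (size s - k)]: the predecessors then all lie in the
    next smaller subspace. *)
Lemma chain_not_quot_findim M L (E : nat -> set X) : is_subspace L ->
  (forall k, is_subspace (E k)) -> (forall k, L `<=` E k) ->
  (forall k, psub (E k.+1) (E k)) -> E 0%N `<=` M -> ~ quot_findim M L.
Proof.
move=> sL sE LE Edec EM [s Ms].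
have /choice[y yE] : forall k, exists y, E k y /\ ~ E k.+1 y.
  by move=> k; have [y Ey nEy] := psub_exists (Edec k); exists y.
have Emono i j := @decreasing_sub E i j Edec.
suff: (size s < size s)%N by rewrite ltnn.
apply: (@free_leq_size L s (fun k => y (size s - k)%N) (size s).+1 sL) => k.
all: rewrite ltnS => ks.
  case: (yE (size s - k)%N) => _ + h; apply; move: h; apply: add_span_min => //.
  move=> x /mapP[j]; rewrite mem_iota add0n => /andP[_ jk] ->.
  have [Ey _] := yE (size s - j)%N; apply: Emono Ey.
  by rewrite ltn_sub2l// (leq_trans jk).
have [Ey _] := yE (size s - k)%N; apply: Ms; apply: EM; exact: Emono Ey.
Qed.

(** Steinitz exchange: since [v] is not in [L], some member of [s] occurs in it with a nonzero
    coefficient, and this member is redundant modulo [F]. *)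
Lemma add_span_exchange L F s v : is_subspace F -> L `<=` F -> F v -> ~ L v ->
  add_span L s v -> exists2 t, (size t).+1 = size s & add_span F s `<=` add_span F t.
Proof.
move=> sF LF Fv nLv; elim: s => [/add_span_nil//|x s IH].
move=> /add_span_cons[a]; have [->|a0] := eqVneq a 0.
  rewrite scale0r subr0 => /IH[t tE st]; exists (x :: t); first by rewrite /= tE.
  by move=> m /add_span_cons[b /st h]; apply/add_span_cons; exists b.
move=> h; exists s => //; have sFs := add_span_subspace s sF.
apply: add_span_min => //; first exact: sub_add_span.
move=> z; rewrite inE => /predU1P[->|]; last exact: mem_add_span.
have -> : x = a^-1 *: (v - (v - a *: x)) by rewrite opprB addrC subrK scalerA mulVf ?scale1r.
apply: subspaceZ => //; apply: subspaceB => //; first exact: sub_add_span.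
by case: h => c Lc; exists c; exact: LF.
Qed.

Lemma free_sequence_exists (L : set X) (Y : nat -> set X) :
  (forall k, ~ quot_findim (Y k) L) ->
  exists y : nat -> X, forall k, Y k (y k) /\ ~ add_span L (mkseq y k) (y k).
Proof.
move=> infY.
have [|y yP] := @seq_choice X (fun s t => Y (size s) t /\ ~ add_span L s t).
  by move=> s; have [t Yt nt] := not_quot_findim (infY (size s)) s; exists t.
by exists y => k; have := yP k; rewrite size_mkseq.
Qed.

Lemma quot_findim_set0 L : is_subspace L -> quot_findim [set 0] L.
Proof. by move=> sL; exists [::] => _ ->; apply/add_span_nil; exact: subspace0. Qed.

Lemma quot_findimD M1 M2 M L : is_subspace L ->
  (forall m, M m -> exists a x y, [/\ M1 x, M2 y & m = a *: x + y]) ->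
  quot_findim M1 L -> quot_findim M2 L -> quot_findim M L.
Proof.
move=> sL MM [s sP] [t tP]; exists (s ++ t) => m /MM[a [x [y [/sP xs /tP yt ->]]]].
have sst := add_span_subspace (s ++ t) sL.
case: (sst) => _; apply.
  apply: add_span_min xs => //; first exact: sub_add_span.
  by move=> z zs; apply: mem_add_span => //; rewrite mem_cat zs.
apply: add_span_min yt => //; first exact: sub_add_span.
by move=> z zs; apply: mem_add_span => //; rewrite mem_cat zs orbT.
Qed.

Lemma is_bop0 : @is_bop K X (fun=> 0).
Proof. by split=> [a x y|x]; [rewrite scaler0 addr0|exact: cst_continuous]. Qed.

Lemma is_bop_lin (a : K) (T S : X -> X) :
  is_bop T -> is_bop S -> is_bop (fun x => a *: T x + S x).
Proof.
move=> [Tl Tc] [Sl Sc]; split.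
  move=> b x y; rewrite Tl Sl !scalerDr !scalerA [b * a]mulrC.
  by rewrite !addrA; congr (_ + _); rewrite -!addrA; congr (_ + _); rewrite addrC.
move=> x; apply: cvgD; last exact: Sc.
by apply: cvgZr; exact: Tc.
Qed.

Lemma is_bop_comp (T S : X -> X) : is_bop T -> is_bop S -> is_bop (T \o S).
Proof.
move=> [Tl Tc] [Sl Sc]; split=> [a x y|x]; first by rewrite /= Sl Tl.
by apply: continuous_comp; [exact: Sc|exact: Tc].
Qed.

End Subspaces.

(** * Bounded functionals and biorthogonal sequences *)

Section Functionals.
Context {R : realType} {X : normedModType R[i]}.
Implicit Types (L M : set X) (s : seq X) (f : X -> R[i]).

Lemma bounded_functional0 f : bounded_functional f -> f 0 = 0.
Proof.
by move=> [fl _]; apply: (addrI (f 0)); have := fl 1 0 0; rewrite scale1r mul1r !addr0.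
Qed.

Lemma bounded_functionalB f x y : bounded_functional f -> f (x - y) = f x - f y.
Proof. by move=> [fl _]; rewrite addrC -scaleN1r fl mulN1r addrC. Qed.

Lemma bounded_functional_sum f I (r : seq I) (P : pred I) (c : I -> R[i]) (z : I -> X) :
  bounded_functional f ->
  f (\sum_(i <- r | P i) c i *: z i) = \sum_(i <- r | P i) c i * f (z i).
Proof.
move=> bf; have f0 := bounded_functional0 bf; case: bf => fl _.
by elim/big_rec2: _ => // i u v _ <-; rewrite fl.
Qed.

Lemma bounded_is_bop (T : X -> X) (C : R) :
  (forall a x y, T (a *: x + y) = a *: T x + T y) ->
  (forall x, `|T x| <= C%:C * `|x|) -> is_bop T.
Proof.
move=> Tl TC; split=> //.
pose Tlin : {linear X -> X} := HB.pack T (GRing.isLinear.Build _ _ _ _ T Tl).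
apply: (@bounded_linear_continuous _ _ _ Tlin).
apply/linear_boundedP; near=> r => x; apply: le_trans (TC x) _.
apply: ler_wpM2r => //; near: r; apply: nbhs_pinfty_ge.
by apply/complex_realP; exists C.
Unshelve. all: by end_near. Qed.

(** Vectors are adjoined one at a time. For [x] outside the closed subspace [L'], a functional [f]
    that kills [L'] with [f x = 1] exhibits the larger space as the preimage of [L'] under the
    bounded map [m |-> m - f m *: x]. *)
Lemma add_span_closed L s : closed_subspace L -> closed_subspace (add_span L s).
Proof.
move=> cL; split; first by apply: add_span_subspace; case: cL.
elim: s => [|x s IH].
  by rewrite (_ : add_span _ _ = L); [case: cL|apply/seteqP; split=> m /add_span_nil].
pose L' := add_span L s; have sL' : is_subspace L' by apply: add_span_subspace; case: cL.
have [L'x|nL'x] := pselect (L' x).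
  rewrite (_ : add_span _ _ = L')//; apply/seteqP; split=> m.
    move=> /add_span_cons[a h]; rewrite -(subrK (a *: x) m).
    by apply: subspaceD => //; exact: subspaceZ.
  by move=> L'm; apply/add_span_cons; exists 0; rewrite scale0r subr0.
have [f [bf fL' fx]] := hahn_banach_separation (conj sL' IH) nL'x.
pose T m := m - f m *: x.
rewrite (_ : add_span _ _ = T @^-1` L').
  apply: preimage_closed => //.
  have [fl [C fC]] := bf.
  suff [] : is_bop T by move=> _ + m _; apply.
  apply: (@bounded_is_bop _ (1 + C * complex.Re `|x|)).
    move=> a u v; rewrite /T fl scalerBr addrACA -opprD scalerDl scalerA//.
  move=> m; rewrite /T; apply: le_trans (ler_normB _ _) _.
  rewrite rmorphD/= rmorph1 rmorphM/= Re_normK mulrDl mul1r lerD2l normrZ.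
  by rewrite mulrAC; apply: ler_wpM2r => //; rewrite fC.
apply/seteqP; split=> m; last by move=> h; apply/add_span_cons; exists (f m).
move=> /add_span_cons[a h]; rewrite /T /=; suff -> : f m = a by [].
have := fL' _ h; have [fl _] := bf.
rewrite bounded_functionalB// -[a *: x]addr0 fl fx bounded_functional0// mulr1 addr0.
by move/eqP; rewrite subr_eq0 => /eqP.
Qed.

(** The hypothesis supplies the next vector, killed by the earlier functionals and outside [B k]
    plus the span of the earlier vectors. That sum is closed, so separation yields the next
    functional, which kills [B k] and the earlier vectors. *)
Lemma biorthogonal_exists (A B : nat -> set X) :
  (forall k, closed_subspace (B k)) ->
  (forall k (x : nat -> X) (f : nat -> X -> R[i]),
     (forall i, (i < k)%N ->
        [/\ A i (x i), bounded_functional (f i) & forall b, B i b -> f i b = 0]) ->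
     (forall i j, (i < k)%N -> (j < k)%N -> f i (x j) = (i == j)%:R) ->
     exists z, [/\ A k z, forall i, (i < k)%N -> f i z = 0
                        & ~ add_span (B k) (mkseq x k) z]) ->
  exists (x : nat -> X) (f : nat -> X -> R[i]),
    (forall k, [/\ A k (x k), bounded_functional (f k) & forall b, B k b -> f k b = 0]) /\
    (forall i j, f i (x j) = (i == j)%:R).
Proof.
move=> cB step.
pose d : X * (X -> R[i]) := (0, fun=> 0).
pose ok k (t : X * (X -> R[i])) :=
  [/\ A k t.1, bounded_functional t.2 & forall b, B k b -> t.2 b = 0].
pose good (s : seq (X * (X -> R[i]))) :=
  (forall i, (i < size s)%N -> ok i (nth d s i)) /\
  (forall i j, (i < size s)%N -> (j < size s)%N ->
     (nth d s i).2 (nth d s j).1 = (i == j)%:R).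
(* Guarding the requirement by [good s] lets [seq_choice] range over all lists; the default pair [d]
   serves the others. *)
pose P (s : seq (X * (X -> R[i]))) t := good s -> [/\ ok (size s) t, t.2 t.1 = 1
  & forall i, (i < size s)%N -> (nth d s i).2 t.1 = 0 /\ t.2 (nth d s i).1 = 0].
have [|u Pu] := @seq_choice _ P.
  move=> s; have [gs|ngs] := pselect (good s); last by exists d.
  have [z [Az fz nz]] := step (size s) (fun i => (nth d s i).1) (fun i => (nth d s i).2) gs.1 gs.2.
  set xs := mkseq _ _ in nz.
  have [f [bf fB fz1]] := hahn_banach_separation (add_span_closed xs (cB (size s))) nz.
  exists (z, f) => _; split=> //=.
    by split=> //= b Bb; apply: fB; exact: sub_add_span.
  move=> i si; split; first exact: fz.
  apply: fB; apply: mem_add_span; first by case: (cB (size s)).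
  by apply/mapP; exists i => //; rewrite mem_iota.
have gu n : good (mkseq u n).
  elim: n => [|n IH]; first by split.
  have [oku u1 u0] := Pu n IH; rewrite size_mkseq in oku u0.
  split; rewrite size_mkseq.
    move=> i; rewrite ltnS leq_eqVlt => /predU1P[->|ltin].
      by rewrite nth_mkseq.
    rewrite nth_mkseq; last by rewrite ltnS ltnW.
    by have := IH.1 i; rewrite size_mkseq nth_mkseq//; apply.
  move=> i j; rewrite !ltnS => lein lejn; rewrite !nth_mkseq//.
  move: lein; rewrite leq_eqVlt => /predU1P[->|ltin].
    move: lejn; rewrite leq_eqVlt => /predU1P[->|ltjn]; first by rewrite eqxx.
    by have [_] := u0 j ltjn; rewrite nth_mkseq// gtn_eqF.
  move: lejn; rewrite leq_eqVlt => /predU1P[->|ltjn].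
    by have [+ _] := u0 i ltin; rewrite nth_mkseq// ltn_eqF.
  by have := IH.2 i j; rewrite size_mkseq !nth_mkseq//; apply.
exists (fun k => (u k).1), (fun k => (u k).2); split=> [k|i j].
  by have := (gu k.+1).1 k; rewrite size_mkseq nth_mkseq//; apply.
have := (gu (maxn i j).+1).2 i j; rewrite size_mkseq !ltnS leq_maxl leq_maxr.
by rewrite !nth_mkseq ?ltnS ?leq_maxl ?leq_maxr//; apply.
Qed.

(** A vector [y] of [A] outside [B k] plus the earlier span exists by infinite dimension;
    subtracting [z], the sum of the [f j y *: x j], makes it vanish under the earlier functionals
    without entering that space. *)
Lemma biorthogonal_infdim (A : set X) (B : nat -> set X) :
  is_subspace A -> (forall k, closed_subspace (B k)) ->
  (forall k, ~ quot_findim A (B k)) ->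
  exists (x : nat -> X) (f : nat -> X -> R[i]),
    (forall k, [/\ A (x k), bounded_functional (f k) & forall b, B k b -> f k b = 0]) /\
    (forall i j, f i (x j) = (i == j)%:R).
Proof.
move=> sA cB infAB; apply: (biorthogonal_exists (A := fun=> A)) => // k x f ok fx.
have [y Ay ny] := not_quot_findim (infAB k) (mkseq x k).
have sB : is_subspace (B k) by case: (cB k).
have sxk : is_subspace (add_span (B k) (mkseq x k)) by exact: add_span_subspace.
pose z := \sum_(j < k) f j y *: x j.
exists (y - z); split.
- apply: subspaceB => //; apply: subspace_sum => // i _; apply: subspaceZ => //.
  by case: (ok i (ltn_ord i)).
- move=> i ik; have [_ bf _] := ok i ik; rewrite bounded_functionalB//.
  rewrite bounded_functional_sum// (bigD1 (Ordinal ik))//= fx// eqxx mulr1.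
  rewrite big1 ?addr0 ?subrr// => j; rewrite -val_eqE/= => ji.
  by rewrite fx// eq_sym (negPf ji) mulr0.
- move=> h; apply: ny; rewrite -(subrK z y); apply: subspaceD => //.
  apply: subspace_sum => // i _; apply: subspaceZ => //; apply: mem_add_span => //.
  by apply/mapP; exists (val i) => //; rewrite mem_iota add0n ltn_ord.
Qed.

(** Here [E k] may have finite codimension in [E 0], so no correction is made: earlier functionals
    already kill [E k]. If [z - w] lies in [E k.+1], with [w] a combination of earlier vectors,
    applying each [f i] shows that the coefficients of [w] vanish, contradicting the choice of
    [z]. *)
Lemma biorthogonal_decreasing (E : nat -> set X) :
  (forall k, closed_subspace (E k)) -> (forall k, psub (E k.+1) (E k)) ->
  exists (x : nat -> X) (f : nat -> X -> R[i]),
    (forall k, [/\ E k (x k), bounded_functional (f k) & forall b, E k.+1 b -> f k b = 0]) /\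
    (forall i j, f i (x j) = (i == j)%:R).
Proof.
move=> cE Edec.
have Emono i j := @decreasing_sub _ _ E i j Edec.
apply: (biorthogonal_exists (A := E) (B := fun k => E k.+1)) => // k x f ok fx.
have [z Ez nz] := psub_exists (Edec k).
have fz0 w i : (i < k)%N -> E k w -> f i w = 0.
  by move=> ik Ew; have [_ _] := ok i ik; apply; exact: Emono Ew.
exists z; split=> // [i ik|]; first exact: fz0.
move=> [c]; rewrite size_mkseq; set w := \sum_(i < k) _ => Ew; apply: nz.
suff w0 : w = 0 by rewrite w0 subr0 in Ew.
rewrite /w big1// => i _; suff -> : c i = 0 by rewrite scale0r.
have [_ bf fE] := ok i (ltn_ord i).
have := fz0 _ i (ltn_ord i) (Emono _ _ (leqnSn k) _ Ew).
rewrite bounded_functionalB// fz0// sub0r bounded_functional_sum// (bigD1 i)//=.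
rewrite nth_mkseq// fx// eqxx mulr1 big1 ?addr0.
  by move/eqP; rewrite oppr_eq0 => /eqP.
by move=> j; rewrite -val_eqE/= => ji; rewrite nth_mkseq// fx// eq_sym (negPf ji) mulr0.
Qed.
End Functionals.

(** * Operators defined by norm-convergent series of rank-one terms *)

Section SeriesOperator.
Context {R : realType} {X : completeNormedModType R[i]}.

Lemma sum_half_pow (m n : nat) : (m <= n)%N ->
  \sum_(m <= k < n) (2^-1 : R) ^+ k <= 2 * 2^-1 ^+ m.
Proof.
move=> mn; have -> : \sum_(m <= k < n) (2^-1 : R) ^+ k = 2 * 2^-1 ^+ m - 2 * 2^-1 ^+ n.
  elim: n mn => [|n IH]; first by rewrite leqn0 => /eqP ->; rewrite big_geq// subrr.
  rewrite leq_eqVlt => /predU1P[->|mn]; first by rewrite big_geq// subrr.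
  by rewrite big_nat_recr// IH//= exprS; field.
by rewrite gerBl mulr_ge0 ?exprn_ge0 ?invr_ge0//.
Qed.

Lemma half_pow_small (r e : R) : 0 < e -> exists N, forall n, (N <= n)%N -> 2 * 2^-1 ^+ n * r < e.
Proof.
move=> e0; exists (Num.truncn (2 * `|r| / e)).+1 => n Nn.
have p0 : 0 < (2 : R) ^+ n by exact: exprn_gt0.
apply: (@le_lt_trans _ _ (2 * 2^-1 ^+ n * `|r|)).
  by rewrite ler_wpM2l ?ler_norm// mulr_ge0 ?exprn_ge0 ?invr_ge0//.
rewrite exprVn mulrAC ltr_pdivrMr// [e * _]mulrC -ltr_pdivrMr//.
apply: lt_trans (truncnS_gt _) _; apply: (@le_lt_trans _ _ n%:R); first by rewrite ler_nat.
by rewrite -natrX ltr_nat ltn_expl.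
Qed.

Lemma series_cvg_half_pow (u : nat -> X) (r : R) :
  (forall k, `|u k| <= (2^-1 ^+ k * r)%:C) -> cvgn (series u).
Proof.
move=> ur; apply/cauchy_cvgP/cauchy_seriesP => e e0.
have eE : e = (complex.Re e)%:C by rewrite RRe_real// gtr0_real.
have e0' : 0 < complex.Re e by rewrite -ltcR -eE.
have r0 : 0 <= r.
  have := ur 0%N; rewrite expr0 mul1r => h.
  by rewrite -ler0c; apply: le_trans h.
have [N hN] := half_pow_small r e0'.
exists ([set n | (N <= n)%N], setT); first by split; [exists N|exact: filterT].
move=> [m n] /= [Nm _]; have [nm|/ltnW mn] := leqP n m; first by rewrite big_geq// normr0.
apply: le_lt_trans (ler_norm_sum _ _ _) _.
apply: le_lt_trans (ler_sum _ (fun k _ => ur k)) _.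
rewrite -rmorph_sum/= -mulr_suml eE ltcR; apply: le_lt_trans (hN m Nm).
by apply: ler_wpM2r => //; exact: sum_half_pow.
Qed.

(* The scalars [c] make the series converge; they do not affect membership of
   its terms in subspaces. *)
Theorem series_operator (f : nat -> X -> R[i]) (y : nat -> X) :
  (forall k, bounded_functional (f k)) ->
  exists (c : nat -> R[i]) (T : X -> X),
    [/\ (forall k, c k != 0), is_bop T,
        (forall V x, closed_subspace V -> (forall k, V (f k x *: y k)) -> V (T x))
      & (forall x k, (forall j, f j x = (j == k)%:R) -> T x = c k *: y k)].
Proof.
move=> bf.
have /choice[C fC] : forall k, exists C : R, 0 <= C /\ forall x, `|f k x| <= C%:C * `|x|.
  move=> k; have [_ [C fC]] := bf k; exists `|C|; split=> // x.
  by apply: le_trans (fC x) _; apply: ler_wpM2r => //; rewrite lecR ler_norm.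
pose Y k := complex.Re `|y k|.
have Y0 k : 0 <= Y k by rewrite -ler0c Re_normK.
(* This bounds the [k]-th term at [x] by [2^-k] times the norm of [x]; the added ones keep the
   denominator positive. *)
pose c k : R := 2^-1 ^+ k / ((C k + 1) * (Y k + 1)).
have den0 k : 0 < (C k + 1) * (Y k + 1).
  by rewrite mulr_gt0// ltr_wpDl//; case: (fC k).
have c0 k : 0 < c k by rewrite divr_gt0 ?exprn_gt0 ?invr_gt0//.
pose u x k := f k x *: ((c k)%:C *: y k).
have ub x k : `|u x k| <= (2^-1 ^+ k * complex.Re `|x|)%:C.
  have cn : `|(c k)%:C : R[i]| = (c k)%:C by rewrite ger0_norm// ler0c ltW.
  rewrite /u !normrZ cn -[`|y k|]Re_normK -/(Y k).
  have [C0 /(_ x)] := fC k; rewrite -[`|x|]Re_normK -rmorphM/= => h.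
  apply: le_trans (ler_wpM2r _ h) _.
    by rewrite -rmorphM ler0c mulr_ge0// ltW.
  rewrite -!rmorphM/= lecR /c.
  have x0 : 0 <= complex.Re `|x| by rewrite -ler0c Re_normK.
  have := den0 k; set d := (C k + 1) * (Y k + 1) => d0.
  rewrite (_ : C k * _ * _ = 2^-1 ^+ k * complex.Re `|x| * (C k * Y k / d)); last by ring.
  apply: ler_piMr; first by rewrite mulr_ge0 ?exprn_ge0 ?invr_ge0//.
  by rewrite ler_pdivrMr// mul1r /d; have := Y0 k; nra.
have cvu x : cvgn (series (u x)) by exact: series_cvg_half_pow (ub x).
pose T x := limn (series (u x)).
have Tu x : series (u x) @ \oo --> T x by exact: cvu.
have Tl a x z : T (a *: x + z) = a *: T x + T z.
  apply: (cvg_unique _ (Tu _)) => //.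
  rewrite (_ : series _ = fun n => a *: series (u x) n + series (u z) n).
    by apply: cvgD => //; apply: cvgZr.
  apply/funext => n; rewrite /series/= scaler_sumr -big_split/=; apply: eq_bigr => k _.
  by rewrite /u; have [fl _] := bf k; rewrite fl scalerDl -scalerA.
have TV V x : closed_subspace V -> (forall k, V (f k x *: y k)) -> V (T x).
  move=> [sV cV] Vf; apply: (closed_cvg V cV _ _ (Tu x)); apply: nearW => n.
  apply: subspace_sum => // k _; rewrite /u scalerA mulrC -scalerA; exact: subspaceZ.
exists (fun k => (c k)%:C), T; split=> //.
- by move=> k; apply/eqP => /complexI/eqP; rewrite gt_eqF.
(* The bound 2 is the sum of the geometric series; it holds for the partial sums and passes to the
   limit up to any [e]. *)
- apply: (@bounded_is_bop _ _ _ 2) => // x.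
  apply/ler_addgt0Pr => e e0.
  have /cvgrPdist_lt/(_ e e0)[n _ /(_ n (leqnn n)) h] := Tu x.
  rewrite -[T x](subrK (series (u x) n)); apply: le_trans (ler_normD _ _) _.
  rewrite addrC; apply: lerD; last exact: ltW.
  apply: le_trans (ler_norm_sum _ _ _) _.
  apply: le_trans (ler_sum _ (fun k _ => ub x k)) _.
  rewrite -rmorph_sum/= -mulr_suml -Re_normK -rmorphM lecR.
  apply: ler_wpM2r; first by rewrite -ler0c Re_normK.
  by have := sum_half_pow (leq0n n); rewrite expr0 mulr1.
- move=> x k fx; apply: (cvg_unique _ (Tu x)) => //.
  apply: cvg_near_cst; exists k.+1 => // n /= kn.
  rewrite /series/= big_mkord (bigD1 (Ordinal kn))//= /u fx eqxx scale1r big1 ?addr0//.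
  by move=> j; rewrite -val_eqE/= => jk; rewrite fx (negPf jk) scale0r.
Qed.
End SeriesOperator.

(** * Order properties of nests, and the parts of the theorem needing no construction of
    operators *)

Section Nests.
Context {K : numFieldType} {X : normedModType K}.
Implicit Types (E F V P Q L M : set X).

Lemma cspan_closed_subspace (S : set X) : closed_subspace (cspan S).
Proof.
split; first split.
- by move=> M [[M0 _] _] _.
- by move=> a x y Sx Sy M cM SM; case: (cM) => -[_ Ml] _; apply: Ml; [exact: Sx|exact: Sy].
rewrite (_ : cspan S = \bigcap_(M in [set M | closed_subspace M /\ S `<=` M]) M).
  by apply: closed_bigI => M [[]].
apply/seteqP; split=> x h M; first by move=> [cM SM]; exact: h.
by move=> cM SM; apply: h.
Qed.

Lemma sub_cspan (S : set X) : S `<=` cspan S.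
Proof. by move=> x Sx M _; apply. Qed.

Lemma cspan_min (S V : set X) : closed_subspace V -> S `<=` V -> cspan S `<=` V.
Proof. by move=> cV SV x; apply. Qed.

Lemma sub_join (S : set (set X)) E : S E -> E `<=` join S.
Proof. by move=> SE x Ex; apply: sub_cspan; exists E. Qed.

Lemma join_min (S : set (set X)) V :
  closed_subspace V -> (forall E, S E -> E `<=` V) -> join S `<=` V.
Proof. by move=> cV SV; apply: cspan_min => // x [E SE]; exact: SV. Qed.

Variable N : set (set X).
Hypothesis nestN : is_nest N.

Lemma nest_closed_subspace E : N E -> closed_subspace E.
Proof. by case: nestN => + _ _ _ _; apply. Qed.

Lemma nest_subspace E : N E -> is_subspace E.
Proof. by move=> /nest_closed_subspace[]. Qed.

Lemma nest_total E F : N E -> N F -> E `<=` F \/ F `<=` E.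
Proof. by case: nestN => _ + _ _ _; apply. Qed.

Lemma nest_not_sub E F : N E -> N F -> ~ E `<=` F -> psub F E.
Proof.
move=> NE NF nEF; have [//|FE] := nest_total NE NF; split=> // FE'.
by apply: nEF; rewrite FE'.
Qed.

Lemma nest_not_psub E F : N E -> N F -> ~ psub E F -> F `<=` E.
Proof. by move=> NE NF nEF; apply: contrapT => /(nest_not_sub NF NE). Qed.

Lemma nest_join (S : set (set X)) : S `<=` N -> N (join S).
Proof. by case: nestN => _ _ _ _ + SN; case/(_ S SN). Qed.

Lemma nest_minus_in E : N (nest_minus N E).
Proof. by apply: nest_join => F []. Qed.

Lemma nest_plus_in E : N (nest_plus N E).
Proof. by case: nestN => _ _ _ _ /(_ [set F | N F /\ psub E F])[] // F []. Qed.

Lemma nest_minus_sub E : N E -> nest_minus N E `<=` E.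
Proof.
by move=> NE; apply: join_min; [exact: nest_closed_subspace|move=> F [_ []]].
Qed.

Lemma sub_nest_minus E F : N F -> psub F E -> F `<=` nest_minus N E.
Proof. by move=> NF FE; exact: sub_join. Qed.

Lemma sub_nest_plus E : E `<=` nest_plus N E.
Proof. by move=> x Ex F [_ [EF _]]; exact: EF. Qed.

Lemma nest_plus_sub E F : N F -> psub E F -> nest_plus N E `<=` F.
Proof. by move=> NF EF x; apply. Qed.

(** Suppose [P] is spanned modulo [L] by finitely many vectors, and induct on their number. A nest
    element strictly between [L] and [P] saves a vector by exchange; if there is none, [L] is the
    predecessor of [P], whence [Ef N P]. *)
Lemma not_Ef_quot_infdim P L :
  N P -> N L -> psub L P -> ~ Ef N P -> ~ quot_findim P L.
Proof.
move=> NP NL LP nEf [s Ps]; apply: nEf.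
have [n sn] : exists n, size s = n by exists (size s).
elim: n s sn L NL LP Ps => [|n IH] s sn L NL LP Ps.
  have [x Px nLx] := psub_exists LP; case: nLx.
  by case: s sn Ps => // _ /(_ x Px) /add_span_nil.
have [[F [NF LF FP]]|noF] := pselect (exists F, [/\ N F, psub L F & psub F P]).
  have [v Fv nLv] := psub_exists LF.
  have [t tE st] := add_span_exchange (nest_subspace NF) (proj1 LF) Fv nLv (Ps _ (proj1 FP _ Fv)).
  apply: (IH t _ F) => //; first by move: tE; rewrite sn => -[].
  by move=> m /Ps[c Lc]; apply: st; exists c; case: LF => + _; apply.
have mL : nest_minus N P = L.
  apply/seteqP; split; last exact: sub_nest_minus.
  apply: join_min => [|F [NF FP]]; first exact: nest_closed_subspace.
  by apply: contrapT => nFL; apply: noF; exists F; split=> //; exact: nest_not_sub.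
split=> //; rewrite mL; last by exists s.
by have [x Px nLx] := psub_exists LP; exists x.
Qed.

Lemma meet_decreasing_sub (u : nat -> set X) Q : (forall k, N (u k)) -> N Q ->
  psub (meet (range u)) Q -> exists k, u k `<=` Q.
Proof.
move=> Nu NQ Pu; apply: contrapT => h; apply: (psub_not_sub Pu) => x Qx _ [k _ <-].
have [//|] := nest_total NQ (Nu k); first exact.
by move=> uQ; exfalso; apply: h; exists k.
Qed.

Lemma meet_decreasing_quot_infdim (u : nat -> set X) L k : (forall k, N (u k)) ->
  (forall k, psub (u k.+1) (u k)) -> N L -> L `<=` meet (range u) ->
  ~ quot_findim (u k) L.
Proof.
move=> Nu du NL Lu.
apply: (@chain_not_quot_findim _ _ _ _ (fun i => u (k + i)%N)).
- exact: nest_subspace.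
- by move=> i; exact: nest_subspace.
- by move=> i; apply: (subset_trans Lu) => x; apply; exists (k + i)%N.
- by move=> i; rewrite addnS.
- by rewrite addn0.
Qed.

Variables Phi Psi : set X -> set X.

Lemma is_bimodule_MPhiPsi : support_fun N Phi ->
  is_bimodule N (MPhi N Phi `&` MePsi N Psi).
Proof.
move=> [NPhi _]; split; first split.
- by move=> T [[]].
- split; split; try exact: is_bop0.
    by move=> E NE _ [x _ <-]; apply: subspace0; apply: nest_subspace; exact: NPhi.
  move=> M L NM NL _; apply: sub_quot_findim (quot_findim_set0 (nest_subspace NL)) => //.
  by move=> _ [x _ <-].
- move=> a T S [[bT TPhi] [_ TPsi]] [[bS SPhi] [_ SPsi]].
  have bTS := is_bop_lin a bT bS; split; split=> //.
    move=> E NE _ [x Ex <-]; have [_ +] := nest_subspace (NPhi _ NE); apply.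
      by apply: (TPhi _ NE); exists x.
    by apply: (SPhi _ NE); exists x.
  move=> M L NM NL ML; apply: quot_findimD (TPsi _ _ NM NL ML) (SPsi _ _ NM NL ML).
    exact: nest_subspace.
  by move=> _ [x Mx <-]; exists a, (T x), (S x); split=> //; exists x.
move=> A T [bA AN] [[bT TPhi] [_ TPsi]]; split; split; split; try exact: is_bop_comp.
- move=> E NE _ [x Ex <-]; apply: (AN _ (NPhi _ NE)); exists (T x) => //.
  by apply: (TPhi _ NE); exists x.
- move=> M L NM NL ML.
  apply: sub_quot_findim (quot_findim_lin (proj1 bA) (AN _ NL) (TPsi _ _ NM NL ML)) => //.
  by move=> _ [x Mx <-]; exists (T x) => //; exists x.
- move=> E NE _ [x Ex <-]; apply: (TPhi _ NE); exists (A x) => //.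
  by apply: (AN _ NE); exists x.
- move=> M L NM NL ML; apply: sub_quot_findim (TPsi _ _ NM NL ML) => //.
  by move=> _ [x Mx <-]; exists (A x) => //; apply: (AN _ NM); exists x.
Qed.

(** For the essential part: if [T M] were infinite-dimensional modulo [L], every [L'] in the meet
    defining [PhieJ N J M] would strictly contain [L], hence contain its successor, and so would
    [Psi M]. *)
Lemma bimodule_sub_MPhiPsi (J : set (X -> X)) : is_bimodule N J ->
  (forall E, N E -> PhiJ J E = Phi E) -> (forall E, N E -> PhieJ N J E = Psi E) ->
  J `<=` MPhi N Phi `&` MePsi N Psi.
Proof.
move=> [[Jbop _ _] _] JPhi JPsi T JT; split; split; try exact: Jbop.
  move=> E NE _ [x Ex <-]; rewrite -JPhi//; apply: sub_cspan.
  by exists T, x.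
move=> M L NM NL ML; apply: contrapT => nq; apply: (psub_not_sub ML).
rewrite -JPsi// => x Lx L' [NL' JL']; apply: (nest_plus_sub NL') Lx.
apply: (nest_not_sub NL' NL) => L'L; apply: nq.
by apply: sub_quot_findim (JL' _ JT).
Qed.

(** If [Psi M] differs from its successor, it is itself one of the [L] in the meet. Otherwise it is
    the meet of the nest elements strictly above it, and all of these occur. *)
Lemma PhieJ_sub : support_fun N Psi ->
  forall M, N M -> PhieJ N (MPhi N Phi `&` MePsi N Psi) M `<=` Psi M.
Proof.
move=> [NPsi _] M NM x h.
have JL L : N L -> psub (Psi M) (nest_plus N L) -> L x.
  by move=> NL ML; apply: h; split=> // T [_ [_]]; apply.
have [eqP|neP] := pselect (Psi M = nest_plus N (Psi M)); last first.
  by apply: JL; [exact: NPsi|split=> //; exact: sub_nest_plus].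
rewrite eqP => L [NL ML]; apply: JL => //; apply: psub_sub_trans ML _.
exact: sub_nest_plus.
Qed.

End Nests.

(** * Attaining [Phi] by rank-one operators *)

Section Main.
Context {R : realType} {X : completeNormedModType R[i]}.
Variables (N : set (set X)) (Phi Psi : set X -> set X).
Hypotheses (nestN : is_nest N) (pN : p_property N) (adm : admissible_pair N Phi Psi).
Local Notation J := (MPhi N Phi `&` MePsi N Psi).

Let NPhi E : N E -> N (Phi E). Proof. by case: adm => -[[+ _] _] _ _ _ _; apply. Qed.
Let NPsi E : N E -> N (Psi E). Proof. by case: adm => _ _ [[+ _] _ _] _ _; apply. Qed.
Let Phi_mono E F : N E -> N F -> E `<=` F -> Phi E `<=` Phi F.
Proof. by case: adm => -[[_ +] _] _ _ _ _; apply. Qed.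
Let Psi_mono E F : N E -> N F -> E `<=` F -> Psi E `<=` Psi F.
Proof. by case: adm => _ _ [[_ +] _ _] _ _; apply. Qed.
Let Psi_Phi E : N E -> Psi E `<=` Phi E. Proof. by case: adm => _ _ _ + _; apply. Qed.

(** The range is spanned by [y], so the essential condition is automatic and only the condition on
    [Phi] has to be assumed. *)
Lemma rank_one_mem (f : X -> R[i]) (y : X) : bounded_functional f ->
  (forall F, N F -> (forall b, F b -> f b = 0) \/ Phi F y) ->
  J (fun x => f x *: y).
Proof.
move=> bf fy.
have bT : is_bop (fun x => f x *: y).
  have [fl [C fC]] := bf; apply: (@bounded_is_bop _ _ _ (C * complex.Re `|y|)).
    by move=> a u v; rewrite fl scalerDl scalerA.
  move=> x; rewrite normrZ rmorphM/= Re_normK mulrAC; exact: ler_wpM2r.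
split; split=> //.
  move=> F NF _ [x Fx <-]; have sF := nest_subspace nestN (NPhi NF).
  case: (fy _ NF) => [->//|Fy]; last exact: subspaceZ.
  by rewrite scale0r; exact: subspace0.
move=> M L NM NL _; exists [:: y] => _ [x _ <-]; exists (fun=> f x).
rewrite big_ord_recl big_ord0 addr0 subrr.
by apply: subspace0; exact: (nest_subspace nestN) NL.
Qed.

Lemma rank_one_PhiJ (E F : set X) (y : X) : N E -> N F -> psub E F ->
  (forall G, N G -> ~ G `<=` E -> Phi G y) -> PhiJ J F y.
Proof.
move=> NE NF EF yP; have [x Fx nEx] := psub_exists EF.
have [f [bf fE fx]] := hahn_banach_separation (nest_closed_subspace nestN NE) nEx.
apply: sub_cspan; exists (fun x => f x *: y), x; split=> //; last by rewrite fx scale1r.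
apply: rank_one_mem => // G NG; have [GE|nGE] := pselect (G `<=` E).
  by left=> b /GE; exact: fE.
by right; exact: yP.
Qed.

(** If [E] is its own predecessor, admissibility makes [Phi E] the join of the [Phi F] with [F]
    strictly inside [E], and the gap from [F] to [E] carries the functional. Otherwise the gap from
    the predecessor to [E] does, since any nest element not inside the predecessor contains [E]. *)
Lemma PhiJ_eq (E : set X) : N E -> PhiJ J E = Phi E.
Proof.
move=> NE; apply/seteqP; split.
  apply: cspan_min; first exact: (nest_closed_subspace nestN (NPhi NE)).
  by move=> _ [T [x [[[_ +] _] Ex ->]]] => /(_ _ NE); apply; exists x.
have cJ : closed_subspace (PhiJ J E) by exact: cspan_closed_subspace.
have [E0|nE0] := pselect (E = [set 0]).
  have [_ Phi0 _ _ _] := adm; move=> y; rewrite [X in Phi X]E0 Phi0 => ->.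
  by apply: subspace0; case: cJ.
have [Em|nEm] := pselect (E = nest_minus N E).
  have [[_ aPhi] _ _ _ _] := adm; rewrite {1}Em -aPhi//.
  apply: join_min => // _ [F [NF FE] <-] y Fy.
  apply: (rank_one_PhiJ NF) => // G NG nGF.
  by apply: (Phi_mono NF NG) => //; case: (nest_not_sub nestN NG NF nGF).
move=> y Ey; apply: (rank_one_PhiJ (nest_minus_in nestN E)) => //.
  by split; [exact: (nest_minus_sub nestN)|move/esym].
move=> G NG nG; apply: (Phi_mono NE NG) => //; apply: contrapT => nEG.
by apply: nG; apply: sub_nest_minus => //; exact: (nest_not_sub nestN NE NG).
Qed.

(** * Attaining [Psi]: an operator of infinite rank modulo a given smaller nest element *)

Section Witness.
Variables (M L : set X).
Hypotheses (NM : N M) (NL : N L) (LP : psub L (Psi M)).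
Local Notation P := (Psi M).

Let NP : N P. Proof. exact: NPsi. Qed.

(** Collects what the sequences must satisfy: the fifth hypothesis on them gives [MPhi], the last
    two give [MePsi], and the first four make the images of the [x k] independent modulo [L]. *)
Lemma series_witness (x : nat -> X) (f : nat -> X -> R[i]) (y : nat -> X) :
  (forall k, M (x k)) -> (forall k, bounded_functional (f k)) ->
  (forall i j, f i (x j) = (i == j)%:R) ->
  (forall k, ~ add_span L (mkseq y k) (y k)) ->
  (forall k F, N F -> (forall b, F b -> f k b = 0) \/ Phi F (y k)) ->
  (forall F, N F -> psub (Psi F) P ->
     exists k0, forall k, (k0 <= k)%N -> forall b, F b -> f k b = 0) ->
  (forall L', N L' -> psub P (nest_plus N L') ->
     exists k0, forall k, (k0 <= k)%N -> L' (y k)) ->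
  exists T, J T /\ ~ quot_findim (T @` M) L.
Proof.
move=> Mx bf fx yfree fPhi fS yL.
have [c [T [c0 bT TV Tx]]] := series_operator y bf.
exists T; split; first split; first split=> //.
- move=> F NF _ [b Fb <-]; have cF := nest_closed_subspace nestN (NPhi NF).
  apply: TV => // k; have [f0|Fy] := fPhi k F NF.
    by rewrite f0// scale0r; apply: subspace0; case: cF.
  by apply: subspaceZ => //; case: cF.
- split=> // M' L' NM' NL' M'L'.
  have sL' := nest_subspace nestN NL'.
  (* Only finitely many terms survive modulo [L']: either [Psi M'] contains [P] and the [y k] end up
     in [L'], or it is strictly smaller and the [f k] end up killing [M']. *)
  have [k0 hk0] : exists k0, forall k b, (k0 <= k)%N -> M' b -> L' (f k b *: y k).
    have [PM'|nPM'] := pselect (P `<=` Psi M').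
      have [k0 h] := yL _ NL' (sub_psub_trans PM' M'L').
      by exists k0 => k b /h yk _; exact: subspaceZ.
    have M'P := nest_not_sub nestN NP (NPsi NM') nPM'.
    have [k0 h] := fS _ NM' M'P.
    by exists k0 => k b /h fk /fk ->; rewrite scale0r; exact: subspace0.
  exists (mkseq y k0) => _ [b M'b <-].
  apply: (TV (add_span L' (mkseq y k0))).
    by apply: add_span_closed; exact: (nest_closed_subspace nestN).
  move=> k; have [k0k|kk0] := leqP k0 k; first by apply: sub_add_span; exact: hk0.
  apply: subspaceZ; first exact: add_span_subspace.
  by apply: mem_add_span => //; apply: map_f; rewrite mem_iota.
- have sL := nest_subspace nestN NL.
  apply: (@free_not_quot_findim _ _ _ _ (fun k => c k *: y k)) => // k.
    move=> h; apply: (yfree k); have -> : y k = (c k)^-1 *: (c k *: y k).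
      by rewrite scalerA mulVf// scale1r.
    have sy := add_span_subspace (mkseq y k) sL.
    apply: subspaceZ => //; apply: add_span_min h => //; first exact: sub_add_span.
    move=> _ /mapP[i ik ->]; apply: subspaceZ => //.
    by apply: mem_add_span => //; exact: map_f.
  by exists (x k) => //; apply: Tx => j; rewrite fx.
Qed.

Let S : set (set X) := [set F | N F /\ psub (Psi F) P].
Let D : set X := join S.

Let ND : N D. Proof. by apply: (nest_join nestN) => // F []. Qed.
Let SD F : S F -> F `<=` D. Proof. exact: sub_join. Qed.
Let nS_Phi F : N F -> ~ S F -> P `<=` Psi F.
Proof.
by move=> NF nS; apply: (nest_not_psub nestN) => //; [exact: NPsi|move=> h; exact: nS].
Qed.
Let DM : D `<=` M.
Proof.
apply: join_min; first exact: (nest_closed_subspace nestN).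
move=> F [NF FP]; apply: contrapT => /(nest_not_sub nestN NF NM)[MF _].
by apply: (psub_not_sub FP); exact: Psi_mono.
Qed.
Let sub_S F G : N F -> F `<=` G -> S G -> S F.
Proof.
by move=> NF FG [NG GP]; split=> //; apply: sub_psub_trans GP; exact: Psi_mono.
Qed.

Let y_tail_infinite (y : nat -> X) : (forall k, P (y k)) ->
  forall L', N L' -> psub P (nest_plus N L') ->
  exists k0, forall k, (k0 <= k)%N -> L' (y k).
Proof.
move=> Py L' NL' PL'; exists 0%N => k _; apply: (nest_not_psub nestN NL' NP) => // L'P.
by apply: (psub_not_sub PL'); exact: nest_plus_sub.
Qed.

(** * Approaching [P] from above when it is in [Ef] *)

Section EssentialFinite.
Hypothesis EfP : Ef N P.

Lemma Ef_plus : P = nest_plus N P.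
Proof. by case: adm => _ _ [_ + _] _ _; apply. Qed.

(** Equality would squeeze [Psi F] to [P], and then the strictness clause of [admissible_pair] at
    [F] fails. *)
Lemma Ef_Phi F : N F -> ~ S F -> psub P (Phi F).
Proof.
move=> NF /(nS_Phi NF) PF; split; first by apply: (subset_trans PF); exact: Psi_Phi.
move=> PE; have FP : Psi F = P.
  by apply/seteqP; split=> //; rewrite PE; exact: Psi_Phi.
have [_ _ _ _ /(_ F NF)] := adm; rewrite FP => /(_ EfP) [_].
by rewrite -PE.
Qed.

Lemma Ef_decreasing : exists u : nat -> set X,
  [/\ forall k, N (u k), forall k, psub (u k.+1) (u k) & meet (range u) = P].
Proof.
have PM : psub P (Phi M) by apply: Ef_Phi => // -[_ [_]]; exact.
have PT : P <> setT by move=> PT; apply: (psub_not_sub PM); rewrite PT.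
by have [u [Nu [du mu]]] := proj2 pN _ NP PT Ef_plus; exists u.
Qed.

Lemma y_tail_finite (u : nat -> set X) (y : nat -> X) (j : nat -> nat) :
  (forall k, N (u k)) -> (forall k, psub (u k.+1) (u k)) -> meet (range u) = P ->
  (forall k, (k <= j k)%N) -> (forall k, u (j k) (y k)) ->
  forall L', N L' -> psub P (nest_plus N L') ->
  exists k0, forall k, (k0 <= k)%N -> L' (y k).
Proof.
move=> Nu du mu jk uy L' NL' PL'.
(* Since [P] is its own successor, [L' = P] is excluded, so the sequence decreasing to [P] enters
   [L']. *)
have PL : psub P L'.
  split.
    apply: (nest_not_psub nestN NL' NP) => L'P.
    by apply: (psub_not_sub PL'); exact: nest_plus_sub.
  by move=> PE; case: PL'; rewrite -PE -Ef_plus.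
rewrite -mu in PL; have [k0 uL] := meet_decreasing_sub nestN Nu NL' PL.
exists k0 => k k0k; apply: uL; exact: (decreasing_sub du (leq_trans k0k (jk k)) (uy k)).
Qed.

End EssentialFinite.

(** * The case where [Psi D] is strictly inside [P] *)

Section JoinInside.
Hypothesis SDin : S D.

(** [M / D] is infinite-dimensional, since otherwise [Psi M = Psi D]. Hence all [f k] can kill the
    one subspace [D], and [y k] need only lie in [Phi F] for the [F] outside [S]. *)
Lemma witness_inside_const (Y : nat -> set X) :
  (forall k, ~ quot_findim (Y k) L) ->
  (forall k F, N F -> ~ S F -> Y k `<=` Phi F) ->
  (forall y, (forall k, Y k (y k)) ->
     forall L', N L' -> psub P (nest_plus N L') ->
     exists k0, forall k, (k0 <= k)%N -> L' (y k)) ->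
  exists T, J T /\ ~ quot_findim (T @` M) L.
Proof.
move=> infY YPhi Ytail.
have infMD : ~ quot_findim M D.
  move=> q; have [_ _ [_ _ /(_ D M ND NM DM q) MD] _ _] := adm.
  by case: SDin => _ [_]; rewrite MD.
have [x [f [xf fx]]] := biorthogonal_infdim (nest_subspace nestN NM)
  (fun=> nest_closed_subspace nestN ND) (fun=> infMD).
have [y yY] := free_sequence_exists infY.
have f0 k F : S F -> forall b, F b -> f k b = 0.
  by move=> SF b /(SD SF); have [_ _] := xf k; apply.
apply: (@series_witness x f y) => //.
- by move=> k; have [] := xf k.
- by move=> k; have [] := xf k.
- by move=> k; have [] := yY k.
- move=> k F NF; have [SF|nSF] := pselect (S F); first by left; exact: f0.
  by right; apply: (YPhi k) => //; have [] := yY k.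
- by move=> F NF FP; exists 0%N => k _; apply: f0.
- by apply: Ytail => k; have [] := yY k.
Qed.

Lemma witness_inside_infinite : ~ Ef N P ->
  exists T, J T /\ ~ quot_findim (T @` M) L.
Proof.
move=> nEf; apply: (@witness_inside_const (fun=> P)).
- by move=> _; exact: (not_Ef_quot_infdim nestN).
- by move=> _ F NF nS; apply: subset_trans (Psi_Phi NF); exact: nS_Phi.
- by move=> y; exact: y_tail_infinite.
Qed.

Lemma witness_inside_finite : Ef N P ->
  exists T, J T /\ ~ quot_findim (T @` M) L.
Proof.
move=> EfP; have [u [Nu du mu]] := Ef_decreasing EfP.
have Lu : L `<=` meet (range u) by rewrite mu; case: LP.
have infu k : ~ quot_findim (u k) L by exact: (meet_decreasing_quot_infdim nestN Nu du NL Lu).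
have nS_above F : psub D F -> ~ S F by move=> DF /SD; exact: (psub_not_sub DF).
have u_below Q : N Q -> psub P Q -> exists j, u j `<=` Q.
  by move=> NQ; rewrite -mu; exact: (meet_decreasing_sub nestN).
(* If [D] has a strict successor, every [F] outside [S] contains it, so one [u j] fits into all the
   [Phi F]. Otherwise the [Phi F] may shrink with [F], and [f k] and [y k] are matched along a
   sequence decreasing to [D]. *)
have [Dp|nDp] := pselect (D = nest_plus N D); last first.
  have NDp := nest_plus_in nestN D.
  have DDp : psub D (nest_plus N D) by split=> //; exact: sub_nest_plus.
  have [j uj] := u_below _ (NPhi NDp) (Ef_Phi EfP NDp (nS_above _ DDp)).
  apply: (@witness_inside_const (fun k => u (j + k)%N)) => //.
    move=> k F NF nSF; apply: (subset_trans (decreasing_sub du (leq_addr k j))).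
    apply: (subset_trans uj); apply: Phi_mono => //; apply: nest_plus_sub => //.
    by apply: (nest_not_sub nestN) => // FD; apply: nSF; exact: sub_S SDin.
  move=> y uy; apply: (y_tail_finite EfP Nu du mu (j := fun k => (j + k)%N)) => //.
  by move=> k; exact: leq_addl.
have DnT : D <> setT.
  move=> DT; have MD : M = D by apply/seteqP; split=> //; rewrite DT.
  by case: SDin => _; rewrite -MD => -[].
have [e [Ne [de me]]] := proj2 pN _ ND DnT Dp.
(* Starting at [j0] places all the [x k] in [M]. *)
have [j0 ej0] : exists j0, e j0 `<=` M.
  apply: (meet_decreasing_sub nestN) => //; rewrite me; split=> // DM'.
  by case: SDin => _; rewrite DM' => -[].
pose E k := e (j0 + k)%N.
have NE k : N (E k) by exact: Ne.
have dE k : psub (E k.+1) (E k) by rewrite /E addnS.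
have De k : D `<=` e k by rewrite -me => b; apply; exists k.
have nSE k : ~ S (E k).
  apply: nS_above; apply: sub_psub_trans (dE k); exact: De.
(* The index [k.+1] matches the subspace killed by [f k]; [k <= j] makes the [y k] approach [P]. *)
have /choice[j jP] : forall k, exists j, (k <= j)%N /\ u j `<=` Phi (E k.+1).
  move=> k; have [i ui] := u_below _ (NPhi (NE k.+1)) (Ef_Phi EfP (NE k.+1) (@nSE k.+1)).
  exists (i + k)%N; split; first exact: leq_addl.
  by apply: subset_trans ui; exact: (decreasing_sub du (leq_addr k i)).
have [x [f [xf fx]]] := biorthogonal_decreasing (fun k => nest_closed_subspace nestN (NE k)) dE.
have [y yY] := free_sequence_exists (fun k => infu (j k)).
apply: (@series_witness x f y) => //.
- move=> k; have [Ex _ _] := xf k; apply: ej0.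
  exact: (decreasing_sub de (leq_addr k j0) Ex).
- by move=> k; have [] := xf k.
- by move=> k; have [] := yY k.
- move=> k F NF; have [FE|EF] := nest_total nestN NF (NE k.+1).
    by left=> b /FE; have [_ _] := xf k; apply.
  right; apply: (Phi_mono (NE k.+1) NF EF); apply: (proj2 (jP k)).
  by have [] := yY k.
- move=> F NF FP; exists 0%N => k _ b Fb; have [_ _] := xf k; apply; apply: De.
  by apply: SD Fb.
- apply: (y_tail_finite EfP Nu du mu (j := j)) => k; first by case: (jP k).
  by have [] := yY k.
Qed.

End JoinInside.

(** * The case where [Psi D] contains [P] *)

Section JoinOutside.
Hypothesis SDout : ~ S D.

Lemma join_outside_neq0 : D <> [set 0].
Proof.
move=> D0; apply: SDout; split=> //.
have PD : Psi D `<=` [set 0].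
  have [_ Phi0 _ _ _] := adm; rewrite -[X in _ `<=` X]Phi0 -D0; exact: Psi_Phi.
apply: sub_psub_trans LP => b /PD ->; apply: subspace0; exact: (nest_subspace nestN) NL.
Qed.

Lemma join_outside_minus : D = nest_minus N D.
Proof.
apply/seteqP; split; last exact: (nest_minus_sub nestN).
apply: join_min; first by apply: (nest_closed_subspace nestN) => //; exact: (nest_minus_in nestN).
move=> F SF; apply: sub_nest_minus; first by case: SF.
by split; [exact: SD|move=> FD; apply: SDout; rewrite -FD].
Qed.

Variable d : nat -> set X.
Hypotheses (Nd : forall k, N (d k)) (incd : forall k, psub (d k) (d k.+1)).
Hypothesis jd : join (range d) = D.

Lemma below_join F : N F -> psub F D -> exists k, F `<=` d k.
Proof.
move=> NF FD; apply: contrapT => h; apply: (psub_not_sub FD); rewrite -jd.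
apply: join_min => [|_ [k _ <-]]; first exact: (nest_closed_subspace nestN).
have [//|Fd] := nest_total nestN (Nd k) NF; exfalso; apply: h; by exists k.
Qed.

(** Admissibility at [D], which is its own predecessor, combined with cofinality of every tail of
    [d] below [D]. *)
Lemma Phi_join_sub (V : set X) k : closed_subspace V ->
  (forall m, (k <= m)%N -> Phi (d m) `<=` V) -> Phi D `<=` V.
Proof.
move=> cV dV; have [[_ aPhi] _ _ _ _] := adm.
rewrite {1}join_outside_minus -aPhi//; last exact: join_outside_neq0.
apply: join_min => // _ [F [NF FD] <-]; have [i Fd] := below_join NF FD.
apply: subset_trans (dV (i + k)%N (leq_addl _ _)); apply: Phi_mono => //.
by apply: (subset_trans Fd); exact: (increasing_sub incd (leq_addr _ _)).
Qed.

(** [D] is its own predecessor, hence not in [Ef], so it is infinite-dimensional modulo each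
    [d (m k)] and [f k] can kill [d (m k)]. Every nest element not inside [d (m k)] has [y k] in its
    [Phi]. *)
Lemma witness_outside (m : nat -> nat) (y : nat -> X) :
  (forall k, (k <= m k)%N) -> (forall k, Phi (d (m k)) (y k)) ->
  (forall k, ~ add_span L (mkseq y k) (y k)) ->
  (forall L', N L' -> psub P (nest_plus N L') ->
     exists k0, forall k, (k0 <= k)%N -> L' (y k)) ->
  exists T, J T /\ ~ quot_findim (T @` M) L.
Proof.
move=> km Py yfree ytail.
have dD k : psub (d k) D.
  by apply: (psub_sub_trans (incd k)); rewrite -jd; apply: sub_join; exists k.+1.
have infD k : ~ quot_findim D (d (m k)).
  apply: (not_Ef_quot_infdim nestN) => // -[_ [b [Db nb]] _]; apply: nb.
  by rewrite -join_outside_minus.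
have [x [f [xf fx]]] := biorthogonal_infdim (nest_subspace nestN ND)
  (fun k => nest_closed_subspace nestN (Nd (m k))) infD.
apply: (@series_witness x f y) => //.
- by move=> k; have [Dx _ _] := xf k; exact: DM.
- by move=> k; have [] := xf k.
- move=> k F NF; have [Fd|dF] := nest_total nestN NF (Nd (m k)).
    by left=> b /Fd; have [_ _] := xf k; apply.
  by right; apply: (Phi_mono (Nd (m k)) NF dF).
- move=> F NF FP; have FD : psub F D.
    by split; [exact: SD|move=> FD; apply: SDout; rewrite -FD].
  have [k0 Fd] := below_join NF FD; exists k0 => k k0k b Fb.
  have [_ _] := xf k; apply; exact: (increasing_sub incd (leq_trans k0k (km k)) (Fd _ Fb)).
Qed.

Lemma witness_outside_infinite : ~ Ef N P ->
  exists T, J T /\ ~ quot_findim (T @` M) L.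
Proof.
move=> nEf; have infP := not_Ef_quot_infdim nestN NP NL LP nEf.
(* Vector and index are chosen together. If no choice were possible, either some [Phi (d m)]
   contains [P], or all late ones lie in [P] and so in the closed span, which then contains [Phi D];
   both ways [P] is finite-dimensional modulo [L]. *)
have [|u uP] := @seq_choice (X * nat) (fun s t =>
    [/\ (size s <= t.2)%N, P t.1, Phi (d t.2) t.1 & ~ add_span L (map fst s) t.1]).
  move=> s; apply: contrapT => h; apply: infP; exists (map fst s) => p Pp.
  have cs : closed_subspace (add_span L (map fst s)).
    by apply: add_span_closed; exact: (nest_closed_subspace nestN).
  have PPhi m : (size s <= m)%N -> P `&` Phi (d m) `<=` add_span L (map fst s).
    move=> sm q [Pq Phiq]; apply: contrapT => nq; apply: h.
    by exists (q, m).
  have [[m [sm Pd]]|nm] := pselect (exists m, (size s <= m)%N /\ P `<=` Phi (d m)).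
    by apply: (PPhi m sm); split=> //; exact: Pd.
  apply: (Phi_join_sub (k := size s) cs); last first.
    by apply: (Psi_Phi ND); apply: nS_Phi.
  move=> m sm q dq; apply: (PPhi m sm); split=> //.
  have [dP|Pd] := nest_total nestN (NPhi (Nd m)) NP; first exact: dP.
  by exfalso; apply: nm; exists m.
pose y k := (u k).1.
have yE k : map fst (mkseq u k) = mkseq y k by rewrite -map_comp.
apply: (@witness_outside (fun k => (u k).2) y).
- by move=> k; have [] := uP k; rewrite size_mkseq.
- by move=> k; have [] := uP k.
- by move=> k; have [] := uP k; rewrite yE.
- by apply: y_tail_infinite => k; have [] := uP k.
Qed.

Lemma witness_outside_finite : Ef N P ->
  exists T, J T /\ ~ quot_findim (T @` M) L.
Proof.
move=> EfP; have [u [Nu du mu]] := Ef_decreasing EfP.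
have Lu : L `<=` meet (range u) by rewrite mu; case: LP.
(* Otherwise all the [Phi (d m)] lie in [P], and then so does [Phi D], against [Ef_Phi]. *)
have [m0 Pm0] : exists m0, psub P (Phi (d m0)).
  apply: contrapT => h; apply: (psub_not_sub (Ef_Phi EfP ND SDout)).
  apply: (Phi_join_sub (k := 0)); first exact: (nest_closed_subspace nestN).
  move=> m _; apply: (nest_not_psub nestN) => //; first exact: NPhi.
  by move=> Pm; apply: h; exists m.
have [j uj] : exists j, u j `<=` Phi (d m0).
  by apply: (meet_decreasing_sub nestN) => //; [exact: NPhi|rewrite mu].
have [y yY] := free_sequence_exists (fun k =>
  meet_decreasing_quot_infdim nestN (k := (j + k)%N) Nu du NL Lu).
apply: (@witness_outside (fun k => m0 + k)%N y).
- by move=> k; exact: leq_addl.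
- move=> k; apply: (Phi_mono (Nd m0)) => //.
    exact: (increasing_sub incd (leq_addr _ _)).
  by apply: uj; have [uy _] := yY k; exact: (decreasing_sub du (leq_addr k j) uy).
- by move=> k; have [] := yY k.
- apply: (y_tail_finite EfP Nu du mu (j := fun k => (j + k)%N)) => k.
    exact: leq_addl.
  by have [] := yY k.
Qed.

End JoinOutside.

Lemma exists_quot_infdim : exists T, J T /\ ~ quot_findim (T @` M) L.
Proof.
have [SDin|SDout] := pselect (S D).
  have [EfP|nEfP] := pselect (Ef N P).
    exact: witness_inside_finite.
  exact: witness_inside_infinite.
have [d [Nd [incd jd]]] := proj1 pN _ ND (join_outside_neq0 SDout) (join_outside_minus SDout).
have [EfP|nEfP] := pselect (Ef N P).
  exact: witness_outside_finite Nd incd jd EfP.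
exact: witness_outside_infinite Nd incd jd nEfP.
Qed.

End Witness.

Lemma sub_PhieJ (M : set X) : N M -> Psi M `<=` PhieJ N J M.
Proof.
move=> NM x Px L [NL JL]; move: x Px; apply: (nest_not_psub nestN) => //; first exact: NPsi.
by move=> LP; have [T [JT nq]] := exists_quot_infdim NM NL LP; apply: nq; exact: JL.
Qed.

End Main.

Theorem mainTheorem17 (R : realType) (X : completeNormedModType (complex R))
  (N : set (set X)) (Phi Psi : set X -> set X) :
  is_nest N -> p_property N -> admissible_pair N Phi Psi ->
  let J := MPhi N Phi `&` MePsi N Psi in
  [/\ is_bimodule N J,
      (forall E, N E -> PhiJ J E = Phi E),
      (forall E, N E -> PhieJ N J E = Psi E)
    & (forall J' : set (X -> X), is_bimodule N J' ->
         (forall E, N E -> PhiJ J' E = Phi E) ->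
         (forall E, N E -> PhieJ N J' E = Psi E) -> J' `<=` J)].
Proof.
move=> nestN pN adm J; have [[sPhi _] _ [sPsi _ _] _ _] := adm; split.
- exact: (is_bimodule_MPhiPsi nestN).
- exact: PhiJ_eq.
- move=> E NE; apply/seteqP; split; first exact: PhieJ_sub.
  exact: sub_PhieJ.
- by move=> J' bJ' JPhi JPsi; exact: (bimodule_sub_MPhiPsi nestN).
Qed.
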